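(* Let $k \geq 4$ be an integer. If $G$ is a $k$-critical graph, then $$|E(G)|\geq \left\lceil \frac{(k+1)(k-2)|V(G)|-k(k-3)}{2(k-1)}\right\rceil .$$ In other words, for every $k\geq 4$ and every integer $n\geq k$ with $n\neq k+1$, $$f_k(n)\geq F(k,n):=\left\lceil \frac{(k+1)(k-2)n-k(k-3)}{2(k-1)}\right\rceil .$$
   Context: Graphs are finite and simple. A graph $G$ is $k$-critical if it is not $(k-1)$-colorable (in the sense of proper vertex colorings), but every proper subgraph of $G$ is $(k-1)$-colorable. $f_k(n)$ denotes the minimum number of edges in a $k$-critical graph with $n$ vertices (for $k \ge 4$, such graphs exist for $n=k$ and for every $n\geq k+2$). *)

(* Defs.v *)
From mathcomp Require Import all_boot all_order all_algebra.

Set Implicit Arguments.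
Unset Strict Implicit.
Unset Printing Implicit Defensive.

Import Order.TTheory GRing.Theory Num.Theory.

(* A finite simple graph whose vertices are taken from an ambient finite type
   T; the vertex set need not be all of T, so that subgraphs of a graph on T
   are again graphs on T. Edges are two-element sets of vertices. *)
Record graph (T : finType) := Graph {
  vertices : {set T};
  edges : {set {set T}};
  edges_wf : [forall e in edges, (e \subset vertices) && (#|e| == 2)]
}.

Definition proper_subgraph (T : finType) (H G : graph T) : Prop :=
  [/\ vertices H \subset vertices G,
      edges H \subset edges G &
      (vertices H, edges H) <> (vertices G, edges G)].

(* The colours are 0, ..., q - 1; values of c outside the vertex set are
   irrelevant. *)
Definition colorable (T : finType) (q : nat) (G : graph T) : Prop :=
  exists c : T -> nat,
    (forall x, x \in vertices G -> c x < q) /\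
    (forall x y, [set x; y] \in edges G -> c x <> c y).

Definition critical (T : finType) (k : nat) (G : graph T) : Prop :=
  ~ colorable k.-1 G /\
  (forall H : graph T, proper_subgraph H G -> colorable k.-1 H).

(* "f_k(n) = m": m is the minimum number of edges of a k-critical graph with
   n vertices. A relation, since f_k(n) is undefined when there is no such
   graph (as for n = k + 1). *)
Definition is_f (k n m : nat) : Prop :=
  (exists (T : finType) (G : graph T),
      [/\ critical k G, #|vertices G| = n & #|edges G| = m]) /\
  (forall (T : finType) (G : graph T),
      critical k G -> #|vertices G| = n -> m <= #|edges G|).

(* The quotient is computed in rat, so that no subtraction is truncated. *)
Definition F (k n : nat) : int :=
  Num.ceil (((k%:R + 1) * (k%:R - 2) * n%:R - k%:R * (k%:R - 3))
            / (2 * (k%:R - 1)) : rat)%R.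

(* Main.v *)
(* Write q = k - 1 and let the potential of a vertex set R be
   (k - 2)(k + 1)|R| - 2(k - 1)|E(R)|; the claim is that a k-critical graph has
   potential at most that of K_k. The argument is that of Kostochka and Yancey.
   Take a minimal counterexample G. Replacing a coloured proper subset R by the
   clique of its colour classes gives a smaller uncolourable graph, and a dense
   subgraph of it, pulled back to G, shows that R has large potential: larger
   than that of one vertex, and in fact at least that of K_(k-1), with equality
   only for K_(k-1) itself. Hence a few edges can be added to any proper part of
   G without destroying its (k-1)-colourability. This controls the vertices of
   degree k - 1: their classes of twins, the degrees of their neighbours, and
   the copies of K_(k-1) containing them. A list-colouring argument with kernels
   bounds the edges between an independent set A of vertices of degree k - 1 and
   a set B of vertices of degree k by |A| + 2|B|. Discharging from the vertices
   of degree at least k to those of degree k - 1 then contradicts the density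
   of G, with separate rules for k <= 5 and k >= 6. *)
Require Import Defs.
From mathcomp Require Import all_boot all_order all_algebra.
From mathcomp Require Import zify lra.

Set Implicit Arguments.
Unset Strict Implicit.
Unset Printing Implicit Defensive.

Import Order.TTheory GRing.Theory Num.Theory.

(** * Edge counts, colourings and potentials *)

(** The governing arithmetic: an edge costs 2q in potential. The potential of K_1 exceeds that of
    K_(q+1) by exactly 2q, and that of K_q exceeds it by q^2 - q + 2. A lower bound on the potential
    of proper subsets is therefore a number of edges that can be added without creating a dense
    subgraph; the bound by K_q allows one edge for every q >= 3, and two only from q = 5 on. This
    separates the two dischargings. With two edges, a vertex of degree k in a K_(k-1) that has a
    vertex u of degree k - 1 is forced to be adjacent to the neighbour of u outside the clique. With
    a single edge this fails, and for k <= 5 an identification shows instead that vertices of degree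
    k - 1 in a K_(k-1) have no twins. The second obstacle is that the kernel bound wants an
    independent set, while vertices of degree k - 1 may be adjacent. For k >= 6 it is applied
    outside the copies of K_(k-1), and the edges into those copies are paid for by a surplus of
    charge there. For k <= 5 the adjacencies among the relevant vertices form a matching, and the
    bound is averaged over two independent halves of it. *)

Definition ecount (T : finType) (e : rel T) (A B : {set T}) : nat :=
  \sum_(x in A) \sum_(y in B) e x y.

Lemma sum_setU (T : finType) (A B : {set T}) (f : T -> nat) : [disjoint A & B] ->
  \sum_(x in A :|: B) f x = \sum_(x in A) f x + \sum_(x in B) f x.
Proof. by move=> dAB; rewrite -bigU //; apply: eq_bigl => x; rewrite !inE. Qed.

Section EdgeCount.

Variables (T : finType) (e : rel T).
Implicit Types (A B C : {set T}) (x y : T).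

Lemma ecountUl A B C : [disjoint A & B] ->
  ecount e (A :|: B) C = ecount e A C + ecount e B C.
Proof. by move=> dAB; rewrite /ecount sum_setU. Qed.

Lemma ecountUr A B C : [disjoint B & C] ->
  ecount e A (B :|: C) = ecount e A B + ecount e A C.
Proof.
move=> dBC; rewrite /ecount -big_split /=; apply: eq_bigr => x _.
by rewrite sum_setU.
Qed.

Lemma ecount1l x B : ecount e [set x] B = \sum_(y in B) e x y.
Proof. by rewrite /ecount big_set1. Qed.

Lemma ecount_sub A B A' B' : A \subset A' -> B \subset B' ->
  ecount e A B <= ecount e A' B'.
Proof.
move=> sA sB; rewrite /ecount.
rewrite (big_setID A) /= [X in _ <= X](big_setID A) /=.
have -> : A :&: A = A by rewrite setIid.
rewrite (setIidPr sA) setDv big_set0 addn0.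
apply: leq_trans (leq_addr _ _); apply: leq_sum => x _.
rewrite [X in _ <= X](big_setID B) /= (setIidPr sB); exact: leq_addr.
Qed.

Lemma ecount_set0l B : ecount e set0 B = 0.
Proof. by rewrite /ecount big_set0. Qed.

Lemma ecount1 x B : ecount e [set x] B = #|[set y in B | e x y]|.
Proof.
rewrite ecount1l -sum1_card big_mkcond /= [RHS]big_mkcond /=.
by apply: eq_bigr => y _; rewrite inE; case: (y \in B) => //=; case: (e x y).
Qed.

Lemma ecount_card A B : ecount e A B = \sum_(x in A) #|[set y in B | e x y]|.
Proof. by apply: eq_bigr => x _; rewrite -ecount1 ecount1l. Qed.

Lemma ecount_leM A B : ecount e A B <= #|A| * #|B|.
Proof.
rewrite ecount_card -sum_nat_const; apply: leq_sum => x _.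
by apply: subset_leq_card; apply/subsetP => y; rewrite inE => /andP[].
Qed.

Lemma eq_in_ecount (e' : rel T) A B :
  {in A & B, forall x y, e x y = e' x y} -> ecount e A B = ecount e' A B.
Proof.
by move=> E; apply: eq_bigr => x xA; apply: eq_bigr => y yB; rewrite E.
Qed.

Hypothesis esym : symmetric e.

Lemma ecountC A B : ecount e A B = ecount e B A.
Proof.
rewrite /ecount exchange_big /=; apply: eq_bigr => x _; apply: eq_bigr => y _.
by rewrite esym.
Qed.

Lemma ecountUU A B : [disjoint A & B] ->
  ecount e (A :|: B) (A :|: B) = ecount e A A + ecount e B B + 2 * ecount e A B.
Proof.
move=> dAB; rewrite ecountUl // !ecountUr // (ecountC B A); lia.
Qed.

Hypothesis eirr : irreflexive e.

Lemma ecount11 x : ecount e [set x] [set x] = 0.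
Proof. by rewrite ecount1l big_set1 eirr. Qed.

Lemma ecount_inner_le A : ecount e A A <= #|A| * #|A|.-1.
Proof.
rewrite ecount_card -sum_nat_const; apply: leq_sum => x xA.
rewrite (cardsD1 x A) xA /=; apply: subset_leq_card.
apply/subsetP => y; rewrite !inE => /andP[-> exy]; rewrite andbT.
by apply: contraTneq exy => ->; rewrite eirr.
Qed.

End EdgeCount.

Definition clique (T : finType) (e : rel T) (X : {set T}) : Prop :=
  {in X &, forall x y, x != y -> e x y}.

Section Clique.

Variables (T : finType) (e : rel T).
Hypotheses (esym : symmetric e) (eirr : irreflexive e).
Implicit Types (X Y : {set T}) (x y : T).

Lemma clique_row X x : clique e X -> x \in X -> ecount e [set x] X = #|X|.-1.
Proof.
move=> cX xX; rewrite ecount1 (cardsD1 x X) xX /=; apply: eq_card => y.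
rewrite !inE andbC; case: (boolP (y \in X)) => yX; rewrite ?andbT ?andbF //.
by case: eqVneq => [->|ne]; [rewrite eirr|rewrite cX // eq_sym].
Qed.

Lemma clique_ecount X : clique e X -> ecount e X X = #|X| * #|X|.-1.
Proof.
move=> cX; rewrite /ecount -sum_nat_const; apply: eq_bigr => x xX.
by rewrite -ecount1l clique_row.
Qed.

Lemma ecount_clique X : #|X| * #|X|.-1 <= ecount e X X -> clique e X.
Proof.
move=> H x y xX yX nxy; apply: contraLR H => nexy; rewrite -ltnNge.
rewrite ecount_card (bigD1 x) //= -sum_nat_const [ltnRHS](bigD1 x) //= -addSn.
apply: leq_add; last first.
  apply: leq_sum => z /andP[zX _]; rewrite (cardsD1 z X) zX /=.
  apply: subset_leq_card; apply/subsetP => w; rewrite !inE => /andP[-> ezw].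
  by rewrite andbT; apply: contraTneq ezw => ->; rewrite eirr.
rewrite (cardsD1 x X) xX /=; apply: proper_card; apply/properP; split.
  apply/subsetP => w; rewrite !inE => /andP[-> ezw].
  by rewrite andbT; apply: contraTneq ezw => ->; rewrite eirr.
by exists y; rewrite !inE ?yX ?(negbTE nexy) // eq_sym nxy.
Qed.

Lemma sub_clique X Y : Y \subset X -> clique e X -> clique e Y.
Proof. by move=> /subsetP sYX cX x y xY yY; apply: cX; apply: sYX. Qed.

End Clique.

Section Colourings.

Variable q : nat.

Definition col (T : finType) (e : rel T) (V : {set T}) : bool :=
  [exists c : {ffun T -> 'I_q}, [forall x in V, forall y in V, e x y ==> (c x != c y)]].

Definition proper_col (T : finType) (e : rel T) (V : {set T}) (c : T -> 'I_q) : Prop :=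
  {in V &, forall x y, e x y -> c x != c y}.

Variable T : finType.
Implicit Types (e : rel T) (V W : {set T}) (c : T -> 'I_q).

Lemma colP e V : reflect (exists c, proper_col e V c) (col e V).
Proof.
apply: (iffP existsP) => [[c /forall_inP H]|[c H]].
  by exists c => x y xV yV; move/forall_inP: (H x xV) => /(_ y yV)/implyP.
exists [ffun x => c x]; apply/forall_inP => x xV; apply/forall_inP => y yV.
by apply/implyP => exy; rewrite !ffunE; apply: H.
Qed.

Lemma free_colour (A : {set 'I_q}) : #|A| < q -> exists n, n \notin A.
Proof.
move=> lt; have /card_gt0P[n] : 0 < #|~: A|.
  by rewrite cardsCs setCK card_ord subn_gt0.
by rewrite inE => nA; exists n.
Qed.

End Colourings.

Section Potential.

Variable q : nat.
Local Open Scope ring_scope.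

(* With k = q + 1 colours and E(R) the edges inside R, this is
   (k - 2)(k + 1)|R| - 2(k - 1)|E(R)|, as [ecount e R R] counts each edge twice. *)
Definition rho (T : finType) (e : rel T) (R : {set T}) : int :=
  ((q * q + q)%:Z - 2) * #|R|%:Z - q%:Z * (ecount e R R)%:Z.

(* Potentials of cliques: of K_r, K_1, K_(q+1) and K_q. *)
Definition rho_K (r : nat) : int :=
  r%:Z * ((q * q)%:Z + 2 * q%:Z - 2 - (q * r)%:Z).
Definition rho_K1 : int := (q * q)%:Z + q%:Z - 2.
Definition rho_max : int := (q * q)%:Z - q%:Z - 2.
Definition rho_Kq : int := 2 * (q * q)%:Z - 2 * q%:Z.

End Potential.

Section CliquePotential.

Variables q r : nat.

(** The potential of K_r is a concave quadratic in r. Its difference with K_1 has roots 1 and q + 1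
    - 2/q, its difference with K_q has roots q and 2 - 2/q; the products in this section are these
    factorisations. *)
Lemma rho_K_ge1 : 1 < q -> 0 < r <= q -> (rho_K1 q <= rho_K q r)%R.
Proof.
move=> q2 rq; rewrite /rho_K1 /rho_K.
have h : q * r <= q * q by rewrite leq_mul2l; lia.
have : (0 <= (r%:Z - 1) * ((q * q)%:Z + q%:Z - 2 - q%:Z * r%:Z))%R by apply: mulr_ge0; lia.
lia.
Qed.

Lemma rho_K_ge2 : 1 < r <= q -> (rho_Kq q <= rho_K q r)%R.
Proof.
move=> rq; rewrite /rho_Kq /rho_K.
have h : q * 2 <= q * r by rewrite leq_mul2l; lia.
have : (0 <= (q%:Z - r%:Z) * (q%:Z * r%:Z - 2 * q%:Z + 2))%R by apply: mulr_ge0; lia.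
lia.
Qed.

Lemma rho_K_gt2 : 1 < r < q -> (rho_Kq q < rho_K q r)%R.
Proof.
move=> rq; rewrite /rho_Kq /rho_K.
have h : q * 2 <= q * r by rewrite leq_mul2l; lia.
have : (0 < (q%:Z - r%:Z) * (q%:Z * r%:Z - 2 * q%:Z + 2))%R by apply: mulr_gt0; lia.
lia.
Qed.

End CliquePotential.

Section PotentialTheory.

Variables (q : nat) (T : finType) (e : rel T).
Hypotheses (esym : symmetric e) (eirr : irreflexive e).
Implicit Types (A B R W : {set T}).

Lemma rho1 x : rho q e [set x] = rho_K1 q.
Proof. by rewrite /rho ecount11 // cards1 /rho_K1; lia. Qed.

Lemma rho0 : rho q e set0 = 0%R.
Proof. by rewrite /rho ecount_set0l cards0; lia. Qed.

Lemma rhoU A B : [disjoint A & B] ->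
  (rho q e (A :|: B) = rho q e A + rho q e B - (2 * q * ecount e A B)%N%:Z)%R.
Proof.
move=> dAB; rewrite /rho ecountUU //.
have -> : #|A :|: B| = #|A| + #|B| by rewrite cardsU disjoint_setI0 // cards0 subn0.
nia.
Qed.

Lemma rhoU1 x A : x \notin A ->
  (rho q e (x |: A) = rho q e A + rho_K1 q - (2 * q * ecount e [set x] A)%N%:Z)%R.
Proof.
move=> xA; rewrite rhoU ?disjoints1 // rho1; lia.
Qed.

Lemma rho_ge_clique R : (rho_K q #|R| <= rho q e R)%R.
Proof.
have H := ecount_inner_le eirr R; rewrite /rho /rho_K.
case: #|R| H => [|r] /= H; first by nia.
have {}H : q * ecount e R R <= q * (r.+1 * r) by rewrite leq_mul2l H orbT.
lia.
Qed.

Lemma rho_clique R : clique e R -> rho q e R = rho_K q #|R|.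
Proof.
move=> cR; rewrite /rho /rho_K clique_ecount //; case: #|R| => [|r] /=; lia.
Qed.

Lemma rho_small R : 1 < #|R| <= q -> (rho_Kq q <= rho q e R)%R.
Proof. by move=> rq; apply: le_trans (rho_ge_clique R); apply: rho_K_ge2. Qed.

Lemma rho_small_clique R : 1 < #|R| <= q -> (rho q e R <= rho_Kq q)%R ->
  #|R| = q /\ clique e R.
Proof.
move=> rq le.
have rE : #|R| = q.
  apply/eqP; rewrite eqn_leq; case/andP: rq => r1 ->; rewrite leqNgt; apply/negP => lt.
  have := rho_K_gt2 (q := q) (r := #|R|); rewrite r1 lt => /(_ isT).
  by rewrite ltNge (le_trans (rho_ge_clique R) le).
split=> //; apply: ecount_clique => //; move: le; rewrite /rho /rho_Kq rE.
nia.
Qed.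

Lemma rho_Kq_clique R : #|R| = q -> clique e R -> rho q e R = rho_Kq q.
Proof. by move=> rE cR; rewrite rho_clique // rE /rho_Kq /rho_K; lia. Qed.

End PotentialTheory.

Section AddEdges.

Variables (T : finType) (e : rel T).
Implicit Types (F : seq (T * T)).

Definition add_edges F : rel T :=
  fun x y => e x y || has (fun p => (x == p.1) && (y == p.2) || (x == p.2) && (y == p.1)) F.

Lemma add_edges_sym F : symmetric e -> symmetric (add_edges F).
Proof.
move=> esym x y; rewrite /add_edges esym; congr (_ || _); apply: eq_has => p /=.
by rewrite orbC; congr (_ || _); rewrite andbC.
Qed.

Lemma add_edges_irr F : irreflexive e -> all (fun p => p.1 != p.2) F ->
  irreflexive (add_edges F).
Proof.
move=> eirr /allP H x; rewrite /add_edges eirr /=; apply/hasP => [[p /H ne]].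
by case/orP => /andP[/eqP E1 /eqP E2]; move: ne; rewrite -E1 -E2 eqxx.
Qed.

(** Only an upper bound, since [F] may repeat a pair or list an edge already present. *)
Lemma ecount_add_edges F W :
  ecount (add_edges F) W W <=
    ecount e W W + 2 * count (fun p => (p.1 \in W) && (p.2 \in W)) F.
Proof.
elim: F => [|p F IH] /=.
  by rewrite addn0; apply: eq_leq; apply: eq_in_ecount => x y _ _; rewrite /add_edges /= orbF.
pose s (p : T * T) : rel T := fun x y => (x == p.1) && (y == p.2).
have one (a b : T) : ecount (s (a, b)) W W <= (a \in W) && (b \in W).
  rewrite /ecount; case: (boolP (a \in W)) => aW /=; last first.
    rewrite leqn0 sum_nat_eq0; apply/forall_inP => x xW; rewrite big1 // => y _.
    by rewrite /s /=; case: eqVneq => // E; rewrite -E xW in aW.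
  rewrite (bigD1 a) //= [X in _ + X]big1 => [|x /andP[_ /negbTE ne]]; last first.
    by rewrite big1 // => y _; rewrite /s /= ne.
  rewrite addn0; case: (boolP (b \in W)) => bW; last first.
    rewrite leqn0 sum_nat_eq0; apply/forall_inP => y yW.
    by rewrite /s /= eqxx /=; case: (eqVneq y b) => // E; rewrite -E yW in bW.
  rewrite (bigD1 b) //= big1 => [|y /andP[_ /negbTE ne]]; last by rewrite /s /= ne andbF.
  by rewrite addn0 leq_b1.
have : ecount (add_edges (p :: F)) W W <= ecount (add_edges F) W W +
    (ecount (s p) W W + ecount (s (p.2, p.1)) W W).
  rewrite /ecount -!big_split; apply: leq_sum => x _; rewrite -!big_split; apply: leq_sum => y _.
  rewrite /add_edges /s /=; move: (e x y) (has _ F) ((x == p.1) && (y == p.2)) ((x == p.2) && (y == p.1)).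
  by do 4 case.
have := one p.1 p.2; have := one p.2 p.1; rewrite andbC -surjective_pairing.
set b := (_ && _); lia.
Qed.

Lemma col_add_edges q F V c : proper_col (q := q) (add_edges F) V c ->
  proper_col e V c.
Proof. by move=> pc x y xV yV exy; apply: pc => //; rewrite /add_edges exy. Qed.

Lemma rho_add_edges q F W :
  (rho q e W <= rho q (add_edges F) W
     + (2 * q * count (fun p => (p.1 \in W) && (p.2 \in W)) F)%N%:Z)%R.
Proof.
have H := ecount_add_edges F W; rewrite /rho.
have : q * ecount (add_edges F) W W <=
    q * (ecount e W W + 2 * count (fun p => (p.1 \in W) && (p.2 \in W)) F).
  by rewrite leq_mul2l H orbT.
lia.
Qed.

End AddEdges.

(** * Weighted edges, Hall's theorem and kernels *)

Section WeightedEdges.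

Variables (T : finType) (w : T -> nat).

Definition units (s : seq T) : seq T := flatten [seq nseq (w u) u | u <- s].

Lemma count_units (P : pred T) s : count P (units s) = \sum_(u <- s | P u) w u.
Proof.
rewrite /units; elim: s => [|u s IH] /=; first by rewrite big_nil.
by rewrite count_cat IH big_cons count_nseq; case: (P u); rewrite ?mul1n ?mul0n.
Qed.

Lemma mem_units s x : x \in units s -> x \in s.
Proof.
by case/flattenP => l /mapP[u us ->]; rewrite mem_nseq => /andP[_ /eqP->].
Qed.

(** The copies of a vertex form one block, so two positions hold distinct vertices when no weight
    exceeds their distance. *)
Lemma units_gap x0 s i j : uniq s -> i <= j < size (units s) ->
  nth x0 (units s) i = nth x0 (units s) j -> j - i < w (nth x0 (units s) i).
Proof.
rewrite /units; elim: s i j => [|u s IH] i j /=; first by rewrite ltn0 andbF.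
case/andP => us uns; rewrite size_cat size_nseq !nth_cat size_nseq => ij.
case: ltnP => hi; case: ltnP => hj.
- rewrite nth_nseq hi => _; lia.
- rewrite nth_nseq hi => E; case/negP: us; apply: mem_units; rewrite E.
  by apply: mem_nth; rewrite -/(units s) ltn_subLR //; case/andP: ij.
- lia.
move=> /IH H; have := H uns; lia.
Qed.

(* A star if some weight is at least i; otherwise line up 2i units of weight,
   those of each vertex consecutively, and join the j-th unit to the (i+j)-th. *)
Lemma heavy_complement (R : {set T}) i : 1 < #|R| -> 2 * i <= \sum_(u in R) w u ->
  exists2 F : seq (T * T), size F = i &
    {in F, forall p, [/\ p.1 \in R, p.2 \in R & p.1 != p.2]} /\
    (forall M : {set T}, {in F, forall p, ~~ ((p.1 \in M) && (p.2 \in M))} ->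
      (exists x y, [/\ x \in M :&: R, y \in M :&: R, x != y, 0 < w x & 0 < w y]) ->
      i <= \sum_(u in R :\: M) w u).
Proof.
move=> R2 wR.
have wD (M : {set T}) : \sum_(u in R :\: M) w u = \sum_(u <- enum R | u \notin M) w u.
  rewrite big_enum_cond; apply: eq_bigl => u; by rewrite inE andbC.
have [/exists_inP[u uR wu]|/exists_inPn wlt] := boolP [exists u in R, i <= w u].
  have [z zR zu] : exists2 z, z \in R & z != u.
    have /card_gt0P[z] : 0 < #|R :\ u| by move: R2; rewrite (cardsD1 u R) uR.
    by rewrite !inE => /andP[zu zR]; exists z.
  pose l := [seq v <- enum R | (v != u) && (0 < w v)].
  have lP v : v \in l = [&& v != u, 0 < w v & v \in R].
    by rewrite mem_filter mem_enum -andbA.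
  exists [seq (u, nth z l j) | j <- iota 0 i]; first by rewrite size_map size_iota.
  have nP j : nth z l j \in R /\ nth z l j != u.
    have [h|h] := ltnP j (size l); last by rewrite nth_default.
    by have := mem_nth z h; rewrite lP => /and3P[].
  split=> [_ /mapP[j _ ->] /=|M HM [x [y [xM yM xy wx wy]]]].
    by have [? ?] := nP j; split; rewrite // eq_sym.
  have [uM|uM] := boolP (u \in M); last first.
    by rewrite (bigD1 u) /= ?inE ?uM //; lia.
  (* M contains u and a second vertex of positive weight. With fewer than i entries in [l], that
     vertex would be joined to u inside M. *)
  have il : i <= size l.
    rewrite leqNgt; apply/negP => lt.
    have [v [vM vu wv]] : exists v, [/\ v \in M :&: R, v != u & 0 < w v].
      case: (eqVneq x u) => [E|]; last by exists x.
      by exists y; split; rewrite // -E eq_sym.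
    move: vM; rewrite inE => /andP[vM vR].
    have vl : v \in l by rewrite lP vu wv.
    have := HM (u, v); rewrite /= uM vM; case/(_ _)/negP => //.
    apply/mapP; exists (index v l); last by rewrite nth_index.
    rewrite mem_iota add0n; apply: leq_ltn_trans lt; exact: index_size.
  rewrite wD.
  apply: (@leq_trans (count (fun v => v \notin M) (take i l))).
    have -> : count (fun v => v \notin M) (take i l) = size (take i l).
      apply/eqP; rewrite -all_count; apply/(all_nthP z) => j.
      rewrite size_take_min => jl; rewrite nth_take; last lia.
      have := HM (u, nth z l j); rewrite /= uM /=; apply.
      by apply/mapP; exists j => //; rewrite mem_iota add0n; lia.
    by rewrite size_take_min; lia.
  apply: (@leq_trans (count (fun v => v \notin M) l)).
    by rewrite -[X in _ <= count _ X](cat_take_drop i) count_cat leq_addr.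
  rewrite -sum1_count big_filter_cond.
  rewrite big_mkcond [X in _ <= X]big_mkcond; apply: leq_sum => v _.
  by case: ifP => // /andP[/andP[_ ?] ->].
pose l := units (enum R).
have sl : size l = \sum_(u in R) w u.
  by rewrite -[size l]count_predT count_units big_enum.
have [z zR] : exists z, z \in R by apply/card_gt0P; lia.
have lR j : j < size l -> nth z l j \in R.
  by move=> /(mem_nth z)/mem_units; rewrite mem_enum.
exists [seq (nth z l j, nth z l (i + j)) | j <- iota 0 i].
  by rewrite size_map size_iota.
split=> [_ /mapP[j + ->] /=|M HM _].
  rewrite mem_iota add0n => /= ji; split; [apply: lR; lia|apply: lR; lia|].
  apply/negP => /eqP E; have := wlt _ (lR j _); rewrite -ltnNge => /(_ _)/=.
  have := units_gap (enum_uniq R) _ E; rewrite -/l => /(_ _).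
  lia.
rewrite wD -count_units -/l.
(* Of the units j and i + j at most one belongs to M, so at least i of the first 2i units lie
   outside M. *)
apply: (@leq_trans (count (fun v => v \notin M) (take (i + i) l))); last first.
  by rewrite -[X in _ <= count _ X](cat_take_drop (i + i)) count_cat leq_addr.
rewrite -sum1_count (big_nth z) size_take_min (minn_idPl _); last lia.
rewrite big_mkcond /= (@big_cat_nat _ _ _ i) //=; last lia.
rewrite [X in _ + X](_ : _ =
  \sum_(0 <= j < i) if nth z (take (i + i) l) (j + i) \notin M then 1 else 0); last first.
  by rewrite -{1}[i]add0n big_addn addnK.
rewrite -big_split /=.
apply: (@leq_trans (\sum_(0 <= j < i) 1)); first by rewrite sum_nat_const_nat; lia.
rewrite !big_nat; apply: leq_sum => j /= ji.
rewrite !nth_take; try lia.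
have /HM /= : (nth z l j, nth z l (i + j)) \in
    [seq (nth z l j, nth z l (i + j)) | j <- iota 0 i].
  by apply/mapP; exists j; rewrite // mem_iota.
by rewrite (addnC i j); case: (_ \in M); case: (_ \in M).
Qed.

End WeightedEdges.

Section Hall.

Variables (I E : finType).

Definition nbh (F : I -> {set E}) (J : {set I}) : {set E} := \bigcup_(i in J) F i.

(** Halmos and Vaughan: if some nonempty proper subset J is tight, match J, and match the rest of D
    outside the neighbourhood of J. Otherwise there is slack everywhere, and any image may be chosen
    for one element. *)
Lemma hall (F : I -> {set E}) (D : {set I}) : 0 < #|E| ->
  (forall J : {set I}, J \subset D -> #|J| <= #|nbh F J|) ->
  exists2 f : I -> E, {in D, forall i, f i \in F i} & {in D &, injective f}.
Proof.
move=> E0; have [x0 _] := card_gt0P E0.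
move: {2}#|D|.+1 (ltnSn #|D|) => n; elim: n F D => // n IH F D; rewrite ltnS => Dn HD.
have [D0|[i iD]] := set_0Vmem D.
  by exists (fun=> x0) => i; rewrite ?D0 inE.
have [/existsP[J /and3P[JD J0 Jt]]|/existsPn Hs] :=
  boolP [exists J : {set I}, [&& J \proper D, J != set0 & #|nbh F J| <= #|J|]].
  have sJD := proper_sub JD.
  have [f1 f1F f1i] := IH F J (leq_trans (proper_card JD) Dn)
    (fun K sK => HD K (subset_trans sK sJD)).
  pose F2 k := F k :\: nbh F J.
  have HD2 (K : {set I}) : K \subset D :\: J -> #|K| <= #|nbh F2 K|.
    rewrite subsetD => /andP[sK dKJ].
    have := HD (K :|: J); rewrite subUset sK sJD => /(_ isT).
    have -> : #|K :|: J| = #|K| + #|J| by rewrite cardsU disjoint_setI0 // cards0 subn0.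
    have : nbh F (K :|: J) \subset nbh F2 K :|: nbh F J.
      apply/subsetP => x; rewrite /nbh bigcup_setU !inE => /orP[|->]; last by rewrite orbT.
      case/bigcupP => k kK xk; case: (boolP (x \in \bigcup_(j in J) F j)) => [|xJ].
        by rewrite orbT.
      by rewrite orbF; apply/bigcupP; exists k; rewrite // inE xJ.
    move/subset_leq_card; have := cardsU (nbh F2 K) (nbh F J); lia.
  have [f2 f2F f2i] : exists2 f : I -> E, {in D :\: J, forall i, f i \in F2 i} &
      {in D :\: J &, injective f}.
    apply: IH HD2; apply: leq_trans Dn; apply: proper_card.
    have [j jJ] := set0Pn _ J0; apply/properP; split; first exact: subsetDl.
    by exists j; rewrite ?(subsetP sJD) // inE jJ.
  exists (fun k => if k \in J then f1 k else f2 k) => [k kD|k l kD lD].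
    case: ifP => kJ; first exact: f1F.
    by have := f2F k; rewrite !inE kJ kD => /(_ isT)/andP[].
  have sep a b : a \in J -> b \in D -> b \notin J -> f1 a <> f2 b.
    move=> aJ bD bJ Eab; have := f2F b; rewrite !inE bJ bD => /(_ isT)/andP[/negP[]].
    by rewrite -Eab; apply/bigcupP; exists a; rewrite ?f1F.
  case: ifP => kJ; case: ifP => lJ.
  - exact: f1i.
  - by move/sep; case; rewrite ?lJ.
  - by move/esym/sep; case; rewrite ?kJ.
  by apply: f2i; rewrite inE ?kJ ?lJ.
have /card_gt0P[x xF] : 0 < #|F i|.
  by have := HD [set i]; rewrite /nbh big_set1 cards1 sub1set => /(_ iD).
pose F2 k := F k :\ x.
have [f fF fi] : exists2 f : I -> E, {in D :\ i, forall i, f i \in F2 i} &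
    {in D :\ i &, injective f}.
  apply: IH => [|K sK]; first by move: Dn; rewrite (cardsD1 i D) iD.
  have [->|K0] := eqVneq K set0; first by rewrite cards0.
  have KD : K \proper D.
    apply/properP; split; first exact: subset_trans sK (subsetDl _ _).
    by exists i => //; apply/negP => /(subsetP sK); rewrite !inE eqxx.
  have := Hs K; rewrite KD K0 /= -ltnNge.
  have : nbh F K :\ x \subset nbh F2 K.
    apply/subsetP => y; rewrite !inE => /andP[yx /bigcupP[k kK yk]].
    by apply/bigcupP; exists k; rewrite // !inE yx.
  move/subset_leq_card; have := cardsD1 x (nbh F K); lia.
exists (fun k => if k == i then x else f k) => [k kD|k l kD lD].
  case: eqP => [->//|/eqP ki]; have := fF k; rewrite !inE ki kD.
  by move=> /(_ isT)/andP[].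
have sep a : a \in D -> a != i -> x <> f a.
  by move=> aD ai Eq; have := fF a; rewrite !inE ai aD -Eq eqxx => /(_ isT).
case: eqP => [->|/eqP ki]; case: eqP => [->|/eqP li] //.
- by move/sep; case.
- by move/esym/sep; case.
by apply: fi; rewrite !inE ?ki ?li.
Qed.

End Hall.

Section KernelColouring.

Variables (T C : finType) (e o : rel T).
Hypothesis C0 : 0 < #|C|.

Definition kernel (K S : {set T}) : Prop :=
  [/\ K \subset S, {in K &, forall x y, ~~ e x y} &
      {in S :\: K, forall x, exists2 y, y \in K & o x y}].

(* Galvin: give a colour to a kernel of the vertices having it in their lists,
   then delete the kernel and the colour. *)
Lemma kernel_list_col (S : {set T}) (L : T -> {set C}) :
  (forall S' : {set T}, S' \subset S -> exists K, kernel K S') ->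
  {in S, forall x, #|[set y in S | o x y]| < #|L x|} ->
  exists2 c : T -> C, {in S, forall x, c x \in L x} &
    {in S &, forall x y, e x y -> c x != c y}.
Proof.
have [g0 _] := card_gt0P C0.
move: {2}#|S|.+1 (ltnSn #|S|) => n; elim: n S L => // n IH S L; rewrite ltnS => Sn kS dL.
have [S0|[x xS]] := set_0Vmem S.
  by exists (fun=> g0) => x; rewrite ?S0 inE.
have /card_gt0P[g gx] : 0 < #|L x| by have := dL x xS; lia.
pose Sg := [set y in S | g \in L y].
have SgS : Sg \subset S by apply/subsetP => y; rewrite inE => /andP[].
have [K [KS Ki Kd]] := kS Sg SgS.
have KS' := subset_trans KS SgS.
have [K0|[z zK]] := set_0Vmem K.
  have [|y] := Kd x; first by rewrite K0 setD0 inE xS.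
  by rewrite K0 inE.
have [c cL pc] : exists2 c : T -> C, {in S :\: K, forall x, c x \in L x :\ g} &
    {in S :\: K &, forall x y, e x y -> c x != c y}.
  apply: IH => [|S' sS'|y]; first 2 last.
  - rewrite inE => /andP[yK yS].
    have sub : [set w in S :\: K | o y w] \subset [set w in S | o y w].
      by apply/subsetP => w; rewrite !inE => /andP[/andP[_ ->] ->].
    have [gy|gy] := boolP (g \in L y); last first.
      have -> : L y :\ g = L y by apply/setDidPl; rewrite disjoint_sym disjoints1.
      exact: leq_ltn_trans (subset_leq_card sub) (dL y yS).
    have [|w wK oyw] := Kd y; first by rewrite !inE yK yS gy.
    have : #|[set w in S :\: K | o y w]| < #|[set w in S | o y w]|.
      apply: proper_card; apply/properP; split=> //.
      by exists w; rewrite !inE ?wK ?oyw ?(subsetP KS').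
    have := dL y yS; have := cardsD1 g (L y); rewrite gy /=; clear; lia.
  - apply: leq_trans Sn; apply: proper_card; apply/properP; split.
      exact: subsetDl.
    by exists z; rewrite ?(subsetP KS') // inE zK.
  by apply: kS; apply: subset_trans sS' (subsetDl _ _).
exists (fun y => if y \in K then g else c y) => [y yS|y w yS wS eyw].
  case: ifP => yK; first by have := subsetP KS _ yK; rewrite inE => /andP[].
  by have := cL y; rewrite !inE yK yS => /(_ isT)/andP[].
have cg u : u \in S -> u \notin K -> c u != g.
  by move=> uS uK; have := cL u; rewrite !inE uK uS => /(_ isT)/andP[].
case: ifP => yK; case: ifP => wK.
- by rewrite (negbTE (Ki _ _ yK wK)) in eyw.
- by rewrite eq_sym cg ?wK.
- by rewrite cg ?yK.
by apply: pc; rewrite ?inE ?yK ?wK.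
Qed.

End KernelColouring.

Section BipartiteKernel.

(* [toB a b] orients the edge between [a] and [b] from [a] to [b]; all edges
   inside [B] are bidirected. *)
Variables (T : finType) (e toB : rel T) (A B : {set T}).
Hypotheses (esym : symmetric e) (eirr : irreflexive e).
Hypothesis Aind : {in A &, forall x y, ~~ e x y}.

Definition arc : rel T := fun x y =>
  e x y && (if x \in A then toB x y else if y \in A then ~~ toB y x else true).

(** If every vertex of S outside A has an arc into S :&: A, that set is a kernel. Otherwise some b
    has none: each neighbour of b in S then has an arc to b, so b can be added to a kernel of its
    non-neighbours. *)
Lemma bipartite_kernel (S : {set T}) : S \subset A :|: B -> exists K, kernel e arc K S.
Proof.
move: {2}#|S|.+1 (ltnSn #|S|) => n; elim: n S => // n IH S; rewrite ltnS => Sn SAB.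
have inB x : x \in S -> x \notin A -> x \in B.
  by move=> /(subsetP SAB); rewrite inE => /orP[->|].
have [/exists_inP[b bS /andP[bA /forall_inP nob]]|/exists_inPn all] := boolP
  [exists b in S, (b \notin A) && [forall a in S :&: A, ~~ arc b a]]; last first.
  exists (S :&: A); split; first exact: subsetIl.
    by move=> x y; rewrite !inE => /andP[_ xA] /andP[_ yA]; apply: Aind.
  move=> x; rewrite !inE => /andP[nx xS]; have := all x xS.
  move: nx; rewrite xS /= => -> /=; rewrite negb_forall_in => /exists_inP[a aSA].
  by rewrite negbK => oa; exists a.
pose S' := [set x in S :\ b | ~~ e x b].
have S'S : S' \subset S by apply/subsetP => x; rewrite !inE => /andP[/andP[]].
have [||K [KS Ki Kd]] := IH S'.
- apply: leq_trans Sn; apply: proper_card; apply/properP; split=> //.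
  by exists b; rewrite // !inE eqxx.
- exact: subset_trans S'S SAB.
have nK x : x \in K -> ~~ e x b by move=> /(subsetP KS); rewrite !inE => /andP[].
exists (b |: K); split.
- by rewrite subUset sub1set bS (subset_trans KS S'S).
- move=> x y; rewrite !inE => /orP[/eqP->|xK] /orP[/eqP->|yK].
  + by rewrite eirr.
  + by rewrite esym nK.
  + exact: nK.
  exact: Ki.
move=> x; rewrite !inE negb_or -andbA => /and3P[xb xK xS].
have [exb|exb] := boolP (e x b); last first.
  have [|y yK oxy] := Kd x; first by rewrite !inE xK xb xS exb.
  by exists y; rewrite // !inE yK orbT.
exists b; first by rewrite !inE eqxx.
rewrite /arc exb /= (negbTE bA); case: ifP => // xA.
have := nob x; rewrite inE xS xA => /(_ isT).
by rewrite /arc esym exb /= (negbTE bA) xA negbK.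
Qed.

End BipartiteKernel.

(** * Minimal counterexamples *)

Lemma sum_imset (T U : finType) (f : T -> U) (A : {set T}) (F : U -> nat) :
  injective f -> \sum_(x in f @: A) F x = \sum_(x in A) F (f x).
Proof. by move=> fi; rewrite big_imset //; apply: in2W. Qed.

Section Collapse.

(* [collapse] replaces the set R by the clique 'I_q of the colour classes of
   the colouring phi of R. *)
Variables (q : nat) (T : finType) (e : rel T) (V R : {set T}) (phi : T -> 'I_q).
Hypotheses (esym : symmetric e) (eirr : irreflexive e).

Definition touches (x : T) (c : 'I_q) : bool := [exists u in R, (phi u == c) && e x u].

Definition collapse : rel (T + 'I_q) := fun x y =>
  match x, y with
  | inl x, inl y => e x y
  | inl x, inr c => touches x c
  | inr c, inl x => touches x c
  | inr c, inr d => c != d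
  end.

Definition collapse_set : {set T + 'I_q} := inl @: (V :\: R) :|: inr @: [set: 'I_q].

Lemma collapse_sym : symmetric collapse.
Proof. by move=> [x|c] [y|d] //=; rewrite eq_sym. Qed.

Lemma collapse_irr : irreflexive collapse.
Proof. by move=> [x|c] /=; rewrite ?eirr ?eqxx. Qed.

Lemma inl_inr_disjoint (A : {set T}) (C : {set 'I_q}) :
  [disjoint (inl @: A : {set T + 'I_q}) & inr @: C].
Proof.
rewrite -setI_eq0; apply/eqP/setP => z; rewrite !inE; apply/negP => /andP[].
by move=> /imsetP[x _ ->] /imsetP[].
Qed.

Lemma inl_inj : injective (inl : T -> T + 'I_q). Proof. by move=> x y []. Qed.
Lemma inr_inj : injective (inr : 'I_q -> T + 'I_q). Proof. by move=> x y []. Qed.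

Lemma card_collapse_set : #|collapse_set| = #|V :\: R| + q.
Proof.
rewrite cardsU disjoint_setI0 ?inl_inr_disjoint // cards0 subn0.
by rewrite (card_imset _ inl_inj) (card_imset _ inr_inj) cardsT card_ord.
Qed.

Lemma collapse_col : proper_col e R phi -> col q collapse collapse_set -> col q e V.
Proof.
move=> pphi /colP[c pc]; apply/colP.
exists (fun x => c (if x \in R then inr (phi x) else inl x)) => x y xV yV exy.
have inc d : inr d \in collapse_set by rewrite inE imset_f ?orbT ?inE.
have inv z : z \in V -> z \notin R -> inl z \in collapse_set.
  by move=> zV zR; rewrite inE imset_f // inE zR.
case: ifP => xR; case: ifP => yR.
- by apply: pc => //=; apply: pphi.
- apply: pc; rewrite ?inc ?inv ?yR //=; apply/exists_inP; exists x => //.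
  by rewrite eqxx esym.
- apply: pc; rewrite ?inc ?inv ?xR //=; apply/exists_inP; exists y => //.
  by rewrite eqxx exy.
by apply: pc; rewrite ?inv ?xR ?yR.
Qed.

Definition contacts (W : {set T}) (C : {set 'I_q}) : nat :=
  \sum_(x in W) \sum_(c in C) touches x c.

(** A vertex with several neighbours in one colour class is joined to that class only once. *)
Lemma contacts_le (W : {set T}) (C : {set 'I_q}) :
  contacts W C <= ecount e W [set u in R | phi u \in C].
Proof.
apply: leq_sum => x _; rewrite (partition_big phi [in C]) /=; last first.
  by move=> u; rewrite inE => /andP[].
apply: leq_sum => c cC; have [/exists_inP[u uR /andP[/eqP uc exu]]|//] := boolP (touches x c).
by rewrite (bigD1 u) /= ?exu // inE uR uc cC eqxx.
Qed.

Lemma rho_collapse (W : {set T + 'I_q}) : W \subset collapse_set ->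
  exists (W0 : {set T}) (C : {set 'I_q}), [/\ W0 \subset V :\: R, W = inl @: W0 :|: inr @: C &
    (rho q collapse W = rho q e W0
       + rho_K q #|C| - (2 * q * contacts W0 C)%N%:Z)%R].
Proof.
move=> sW; pose W0 := [set x | inl x \in W]; pose C := [set c | inr c \in W].
have WE : W = inl @: W0 :|: inr @: C.
  apply/setP => -[x|c]; rewrite inE.
    rewrite (mem_imset _ _ inl_inj) inE.
    by case: (boolP (inl x \in inr @: C)) => [/imsetP[]//|_]; rewrite orbF.
  rewrite (mem_imset _ _ inr_inj) inE.
  by case: (boolP (inr c \in inl @: W0)) => [/imsetP[]//|_].
exists W0, C; split=> //.
  apply/subsetP => x; rewrite inE => /(subsetP sW); rewrite inE => /orP[].
    by rewrite (mem_imset _ _ inl_inj).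
  by case/imsetP.
rewrite {1}WE rhoU ?inl_inr_disjoint //; last exact: collapse_sym.
have -> : rho q collapse (inl @: W0) = rho q e W0.
  rewrite /rho (card_imset _ inl_inj) /ecount sum_imset; last exact: inl_inj.
  congr (_ - _ * _%:Z)%R; apply: eq_bigr => x _; rewrite sum_imset //; exact: inl_inj.
have -> : ecount collapse (inl @: W0) (inr @: C) = contacts W0 C.
  rewrite /ecount sum_imset; last exact: inl_inj.
  by apply: eq_bigr => x _; rewrite sum_imset //; apply: inr_inj.
rewrite (@rho_clique q _ collapse); first by rewrite (card_imset _ inr_inj).
  exact: collapse_irr.
by move=> x y /imsetP[c _ ->] /imsetP[d _ ->] ne /=; apply: contra ne => /eqP->.
Qed.

End Collapse.

Lemma exists_min (I : finType) (P : pred I) (f : I -> int) i0 :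
  P i0 -> exists2 i, P i & forall j, P j -> (f i <= f j)%R.
Proof. by move=> Pi0; case: (arg_minP f Pi0) => i; exists i. Qed.

Definition cnbh (T : finType) (e : rel T) (V : {set T}) (x : T) : {set T} :=
  [set y in V | (y == x) || e x y].

(** Counts ordered pairs, so it is the sum of the squares of the sizes of the twin classes, and at
    most the square of the order. *)
Definition ntwins (T : finType) (e : rel T) (V : {set T}) : nat :=
  \sum_(x in V) \sum_(y in V) (cnbh e V x == cnbh e V y).

(* The last component is needed only in [twin_clique], where a vertex is
   replaced by a twin of a neighbour of the same degree. *)
Definition smaller (T' : finType) (e' : rel T') (V' : {set T'})
    (T : finType) (e : rel T) (V : {set T}) : Prop :=
  #|V'| < #|V| \/ #|V'| = #|V| /\
  (ecount e' V' V' < ecount e V V \/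
   ecount e' V' V' = ecount e V V /\ ntwins e V < ntwins e' V').

(** The form in which the bound goes through induction: it speaks of all uncolourable graphs, so a
    modified graph has only to be smaller and uncolourable, not critical. *)
Definition has_dense (q : nat) (T : finType) (e : rel T) (V : {set T}) : Prop :=
  exists W : {set T}, [/\ W \subset V, ~~ col q e W & (rho q e W <= rho_max q)%R].

Record min_cex (q : nat) (T : finType) (e : rel T) (V : {set T}) : Prop := MinCex {
  cex_q : 3 <= q;
  cex_sym : symmetric e;
  cex_irr : irreflexive e;
  cex_ncol : ~~ col q e V;
  cex_dense : ~ has_dense q e V;
  cex_min : forall (T' : finType) (e' : rel T') (V' : {set T'}),
    symmetric e' -> irreflexive e' -> smaller e' V' e V ->
    ~~ col q e' V' -> has_dense q e' V'
}.

(** * Lower bounds on the potential of proper subsets *)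

Section PotentialOfSubsets.

Variables (q : nat) (T : finType) (e : rel T) (V : {set T}).
Hypothesis G : min_cex q e V.
Implicit Types (A B R W X : {set T}) (x y : T).

Let q3 := cex_q G.
Let esym := cex_sym G.
Let eirr := cex_irr G.

(** A dense subset of W is a dense subset of V for the same relation. This is criticality under
    deletion of vertices. *)
Lemma cex_crit W : W \proper V -> col q e W.
Proof.
move=> pW; apply: contraT => nc; case: (cex_dense G).
have [|W' [sW' nc' r']] := cex_min G esym eirr _ nc; first by left; apply: proper_card.
by exists W'; split=> //; apply: subset_trans sW' (proper_sub pW).
Qed.

Lemma cex_rhoV : (rho_max q < rho q e V)%R.
Proof.
rewrite ltNge; apply/negP => H; apply: (cex_dense G).
by exists V; rewrite (cex_ncol G).
Qed.

Lemma cex_proper R : R \subset V -> R != V -> R \proper V.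
Proof. by move=> sR nR; rewrite properEneq nR. Qed.

(* Collapsing a coloured proper subset R gives a smaller uncolourable graph;
   W0 and C are the two parts of a dense subgraph of it. *)
Lemma cex_collapse R (phi : T -> 'I_q) : R \proper V -> q < #|R| ->
  proper_col e R phi ->
  exists (W0 : {set T}) (C : {set 'I_q}),
    [/\ W0 \subset V :\: R, C != set0 &
      (rho q e W0 + rho_K q #|C| <= rho_max q + (2 * q * contacts e R phi W0 C)%N%:Z)%R].
Proof.
move=> pR qR pphi; have nc := contra (collapse_col esym pphi) (cex_ncol G).
have [|W [sW ncW rW]] := cex_min G (collapse_sym R phi esym) (collapse_irr R phi eirr) _ nc.
  left; rewrite card_collapse_set.
  have := cardsID R V; rewrite (setIidPr (proper_sub pR)); lia.
have [W0 [C [sW0 WE rE]]] := rho_collapse phi esym eirr sW.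
exists W0, C; split=> //; last by rewrite rE in rW; lia.
apply: contra ncW => /eqP C0; rewrite WE C0 imset0 setU0.
have : col q e W0.
  apply: cex_crit; have [x xR] : exists x, x \in R by apply/card_gt0P; lia.
  apply/properP; split; first exact: subset_trans sW0 (subsetDl _ _).
  exists x; first exact: (subsetP (proper_sub pR)).
  by apply/negP => /(subsetP sW0); rewrite inE xR.
case/colP => c pc; apply/colP.
have [x0 _] : exists x, x \in R by apply/card_gt0P; lia.
exists (fun z => if z is inl x then c x else c x0).
by move=> z z' /imsetP[x xW ->] /imsetP[y yW ->] /=; apply: pc.
Qed.

Lemma rhoU_le A B n : [disjoint A & B] -> n <= ecount e A B ->
  (rho q e (A :|: B) <= rho q e A + rho q e B - (2 * q * n)%N%:Z)%R.
Proof.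
move=> dAB le; rewrite rhoU //.
have : 2 * q * n <= 2 * q * ecount e A B by rewrite leq_mul2l le orbT.
lia.
Qed.

Lemma cex_disj W R : W \subset V :\: R -> [disjoint W & R].
Proof. by rewrite subsetD => /andP[]. Qed.

(** Take R of minimal potential. In the dense subgraph given by the collapse, exchange the clique
    part, of potential at least [rho_K1], for R: the union of W0 and R has potential at most that of
    R minus 2q. This contradicts minimality, or the density of V if the union is V. *)
Lemma cex_K1 R : R \proper V -> 1 < #|R| -> (rho_K1 q < rho q e R)%R.
Proof.
move=> pR R1; rewrite ltNge; apply/negP => leR.
pose P R0 := [&& R0 \proper V, 1 < #|R0| & (rho q e R0 <= rho_K1 q)%R].
have {pR R1 leR}/(exists_min (rho q e)) : P R by rewrite /P pR R1.
case=> {}R /and3P[pR R1 leR] minR.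
have qR : q < #|R|.
  rewrite ltnNge; apply/negP => Rq.
  have := rho_small (q := q) eirr (R := R); rewrite R1 Rq => /(_ isT) h.
  have := le_trans h leR; rewrite /rho_Kq /rho_K1.
  have : 3 * q <= q * q by rewrite leq_mul2r q3 orbT.
  lia.
have /colP[phi pphi] := cex_crit pR.
have [W0 [C [sW0 C0 H]]] := cex_collapse pR qR pphi.
have rC : (rho_K1 q <= rho_K q #|C|)%R.
  apply: rho_K_ge1; first exact: ltnW.
  by rewrite card_gt0 C0 -[X in _ <= X]card_ord max_card.
have Hc : contacts e R phi W0 C <= ecount e W0 R.
  apply: leq_trans (contacts_le _ _ _ _ _) _; apply: ecount_sub => //.
  by apply/subsetP => u; rewrite inE => /andP[].
have Hr := rhoU_le (cex_disj sW0) Hc.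
have lt : (rho q e (W0 :|: R) < rho q e R)%R by rewrite /rho_max /rho_K1 in H rC; lia.
have sU : W0 :|: R \subset V.
  by rewrite subUset (subset_trans sW0 (subsetDl _ _)) proper_sub.
have [E|ne] := eqVneq (W0 :|: R) V.
  have := cex_rhoV; rewrite -E /rho_max /rho_K1 in H rC leR *; lia.
have := minR (W0 :|: R); rewrite /P cex_proper //=.
have -> : 1 < #|W0 :|: R| by apply: leq_trans R1 (subset_leq_card (subsetUr _ _)).
rewrite (le_trans (ltW lt) leR) => /(_ isT); by rewrite leNgt lt.
Qed.

Lemma cex_pot W : W \subset V -> W != set0 -> (rho_max q < rho q e W)%R.
Proof.
move=> sW W0; have [->|nW] := eqVneq W V; first exact: cex_rhoV.
have [W1|W1] := ltnP 1 #|W|.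
  have := cex_K1 (cex_proper sW nW) W1; rewrite /rho_K1 /rho_max; lia.
have /eqP/cards1P[x ->] : #|W| = 1 by move: W0; rewrite -card_gt0; lia.
rewrite rho1 // /rho_K1 /rho_max; lia.
Qed.

(* Of the q cyclic shifts of a colouring of V - R, each edge of the cut spoils
   exactly one. *)
Lemma cex_cut R : R \proper V -> R != set0 -> q <= ecount e R (V :\: R).
Proof.
move=> pR R0.
have /colP[c1 pc1] := cex_crit pR.
have pR' : V :\: R \proper V.
  apply: cex_proper; first exact: subsetDl.
  apply/eqP => E; case/set0Pn: R0 => x xR; have := subsetP (proper_sub pR) _ xR.
  by rewrite -E inE xR.
have /colP[c2 pc2] := cex_crit pR'.
have q0 : 0 < q by lia.
pose sh (s : 'I_q) y : 'I_q := Ordinal (ltn_pmod (c2 y + s) q0).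
have sh_inj s y z : sh s y = sh s z -> c2 y = c2 z.
  move/(congr1 val) => /= /eqP; rewrite eqn_modDr !modn_small // => /eqP; exact: val_inj.
have sh_s s t y : sh s y = sh t y -> s = t.
  move/(congr1 val) => /= /eqP; rewrite eqn_modDl !modn_small // => /eqP; exact: val_inj.
have bad s : 1 <= \sum_(x in R) \sum_(y in V :\: R) (e x y && (c1 x == sh s y)).
  rewrite lt0n; apply: contra (cex_ncol G); rewrite sum_nat_eq0 => /forall_inP H.
  have {}H x y : x \in R -> y \in V -> y \notin R -> e x y -> c1 x != sh s y.
    move=> xR yV yR exy; have := H x xR; rewrite sum_nat_eq0 => /forall_inP/(_ y).
    by rewrite inE yV yR exy => /(_ isT); case: (c1 x == sh s y).
  apply/colP; exists (fun x => if x \in R then c1 x else sh s x) => x y xV yV exy.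
  case: ifP => xR; case: ifP => yR; first exact: pc1.
  - by apply: H; rewrite ?yR.
  - by rewrite eq_sym; apply: H; rewrite ?xR // esym.
  apply/eqP => /sh_inj/eqP; apply/negP; apply: pc2; rewrite ?inE ?xR ?yR //.
rewrite -[X in X <= _]card_ord -sum1_card.
apply: (@leq_trans (\sum_(s : 'I_q) \sum_(x in R) \sum_(y in V :\: R) (e x y && (c1 x == sh s y)))).
  by apply: leq_sum => s _; apply: bad.
rewrite exchange_big /=; apply: leq_sum => x _; rewrite exchange_big /=; apply: leq_sum => y _.
case: (e x y) => /=; last by rewrite big1.
rewrite -(big_mkcond (fun s => c1 x == sh s y) (fun _ => 1)) sum1_card.
apply/card_le1_eqP => s t E E'; apply: (@sh_s _ _ y).
by rewrite -(eqP (E : c1 x == sh s y)) -(eqP (E' : c1 x == sh t y)).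
Qed.

End PotentialOfSubsets.

Lemma ncol_neq0 q (T : finType) (e : rel T) (W : {set T}) : 0 < q ->
  ~~ col q e W -> W != set0.
Proof.
move=> q0; apply: contra => /eqP->; apply/colP; exists (fun=> Ordinal q0) => x y.
by rewrite inE.
Qed.

Section Gap.

Variables (q : nat) (T : finType) (e : rel T) (V : {set T}).
Hypothesis G : min_cex q e V.
Implicit Types (R W X : {set T}) (x y : T).

Let q3 := cex_q G.
Let esym := cex_sym G.
Let eirr := cex_irr G.

(* i is the number of edges that may be added to a set of potential r while
   all its potentials stay above the threshold. *)
Lemma rho_steps (r : int) : (rho_K1 q < r <= rho_Kq q)%R ->
  exists i, [/\ 2 * i <= q, (r <= rho_K1 q + (2 * q * i)%N%:Z)%R &
    (rho_max q + (2 * q * i)%N%:Z < r)%R].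
Proof.
case/andP => lo hi.
have ex : exists i, (r <= rho_K1 q + (2 * q * i)%N%:Z)%R.
  by exists (q * q); move: hi; rewrite /rho_Kq /rho_K1; nia.
have [i Hi mini] := ex_minnP ex.
have {mini}Hi' : (rho_max q + (2 * q * i)%N%:Z < r)%R.
  case: i Hi mini => [|i] Hi mini; first by rewrite /rho_max /rho_K1 in lo *; lia.
  rewrite ltNge; apply/negP => h; have := mini i; rewrite ltnn => /(_ _)/negP; apply => //.
  by rewrite /rho_max /rho_K1 in h *; lia.
exists i; split=> //; rewrite leqNgt; apply/negP => lt.
have := lt_le_trans Hi' hi; rewrite /rho_max /rho_Kq.
have : q * q.+1 <= q * (2 * i) by rewrite leq_mul2l lt orbT.
lia.
Qed.

(* Take R of minimal potential and add to it i edges so that in every colouring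
   each class with two boundary vertices misses at least i edges of the cut;
   then collapse R. *)
Lemma cex_big R : R \proper V -> q < #|R| -> (rho_Kq q < rho q e R)%R.
Proof.
move=> pR qR; rewrite ltNge; apply/negP => leR.
pose P R0 := [&& R0 \proper V, q < #|R0| & (rho q e R0 <= rho_Kq q)%R].
have {pR qR leR}/(exists_min (rho q e)) : P R by rewrite /P pR qR.
case=> {}R /and3P[pR qR leR] minR.
have {}minR W : W \proper V -> 1 < #|W| -> (rho q e R <= rho q e W)%R.
  move=> pW W1; have [Wq|qW] := leqP #|W| q.
    by apply: le_trans leR _; apply: rho_small; rewrite // W1.
  have [h|/ltW h] := leP (rho q e W) (rho_Kq q); last exact: le_trans leR h.
  by apply: minR; rewrite /P pW qW.
have R1 : 1 < #|R| by lia.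
have loR := cex_K1 G pR R1.
have [|i [iq hi lo]] := @rho_steps (rho q e R); first by rewrite loR.
pose w u := ecount e [set u] (V :\: R).
have wR (A : {set T}) : \sum_(u in A) w u = ecount e A (V :\: R).
  by apply: eq_bigr => u _; rewrite /w ecount1l.
have R0 : R != set0 by rewrite -card_gt0; lia.
have wtot : 2 * i <= \sum_(u in R) w u by rewrite wR (leq_trans iq) // (cex_cut G).
have [F sF [FR HF]] := heavy_complement R1 wtot.
pose e' := add_edges e F.
have e'irr : irreflexive e'.
  by apply: add_edges_irr => //; apply/allP => p /FR[].
have e'sym : symmetric e' by apply: add_edges_sym.
(* A dense subset of R for e' would have potential at most rho_max + 2qi in G, which is less than
   the minimum attained by R. *)
have /colP[phi pphi] : col q e' R.
  apply: contraT => nc.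
  have [|W [sW ncW rW]] := cex_min G e'sym e'irr _ nc; first by left; apply: proper_card.
  have W0 := ncol_neq0 (ltnW (ltnW q3)) ncW.
  have [W1|W1] := ltnP 1 #|W|.
    have pW := sub_proper_trans sW pR.
    have := minR W pW W1; have := rho_add_edges e q F W.
    have : 2 * q * count (fun p => (p.1 \in W) && (p.2 \in W)) F <= 2 * q * i.
      by rewrite leq_mul2l -sF count_size orbT.
    rewrite -/e'; move: lo rW; clear; lia.
  have /eqP/cards1P[x E] : #|W| = 1 by move: W0; rewrite -card_gt0; lia.
  move: rW; rewrite E rho1 // /rho_K1 /rho_max; lia.
have [W0 [C [sW0 C0 H]]] := cex_collapse G pR qR (col_add_edges pphi).
have sU : W0 :|: R \subset V.
  by rewrite subUset (subset_trans sW0 (subsetDl _ _)) proper_sub.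
have dWR := cex_disj sW0.
have U0 : W0 :|: R != set0 by rewrite setU_eq0 negb_and R0 orbT.
have Cq : 0 < #|C| <= q by rewrite card_gt0 C0 -[X in _ <= X]card_ord max_card.
(* With two classes or more the clique part weighs at least [rho_Kq], hence at least R, and
   exchanging it for R leaves a nonempty set of potential at most [rho_max]. So C is a single
   colour, and its class M is independent for e', hence contains no pair of F. *)
have [C1|C1] := ltnP 1 #|C|.
  have rC : (rho_Kq q <= rho_K q #|C|)%R.
    by apply: rho_K_ge2; rewrite C1; case/andP: Cq.
  have Hc : contacts e R phi W0 C <= ecount e W0 R.
    apply: leq_trans (contacts_le _ _ _ _ _) _; apply: ecount_sub => //.
    by apply/subsetP => u; rewrite inE => /andP[].
  have := rhoU_le G dWR Hc; have := cex_pot G sU U0; move: H rC leR; clear; lia.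
have CE : #|C| = 1 by move: Cq C1; clear; lia.
pose M := [set u in R | phi u \in C].
have MR : M \subset R by apply/subsetP => u; rewrite inE => /andP[].
have rC : rho_K q #|C| = rho_K1 q by rewrite CE /rho_K /rho_K1; clear; lia.
rewrite {}rC in H.
have MF : {in F, forall p, ~~ ((p.1 \in M) && (p.2 \in M))}.
  move=> p pF; apply/negP => /andP[]; rewrite !inE => /andP[p1R p1C] /andP[p2R p2C].
  have /eqP/cards1P[c Cc] := CE.
  have := pphi _ _ p1R p2R; move: p1C p2C; rewrite Cc !inE => /eqP-> /eqP->.
  rewrite eqxx; case/(_ _)/negP => //; apply/orP; right; apply/hasP; exists p => //.
  by rewrite !eqxx.
(* Boundary vertices are those of positive weight. If M has two of them, [heavy_complement] provides
   i edges of the cut that the contacts do not count. *)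
have [/existsP[x /existsP[y /and5P[xM yM xy wx wy]]]|nosup] := boolP [exists x, exists y,
    [&& x \in M, y \in M, x != y, 0 < w x & 0 < w y]].
  have heavy : i <= \sum_(u in R :\: M) w u.
    apply: HF MF _; exists x, y; split=> //; rewrite inE ?xM ?yM /=.
      exact: (subsetP MR).
    exact: (subsetP MR).
  (* A proper union contradicts minimality as in [cex_K1]. If the union is V, the i further edges
     bring its potential down to rho_K1 - 2q, that is, to [rho_max]. *)
  have [E|ne] := eqVneq (W0 :|: R) V; last first.
    have Hc : contacts e R phi W0 C <= ecount e W0 R.
      apply: leq_trans (contacts_le _ _ _ _ _) _; exact: ecount_sub.
    have := minR _ (cex_proper sU ne) (leq_trans R1 (subset_leq_card (subsetUr _ _))).
    have := rhoU_le G dWR Hc; move: H; rewrite /rho_max /rho_K1; move: q3; clear; lia.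
  have W0E : W0 = V :\: R.
    by rewrite -E setDUl setDv setU0 (setDidPl dWR).
  have Hc : contacts e R phi W0 C + i <= ecount e W0 R.
    have RE : R = M :|: (R :\: M) by rewrite -{1}(setID R M) (setIidPr MR).
    rewrite [X in _ <= ecount _ _ X]RE ecountUr; last by rewrite disjoint_sym disjoints_subset subDset setUCr subsetT.
    apply: leq_add; first exact: contacts_le.
    by rewrite W0E (ecountC esym) -wR.
  have := rhoU_le G dWR Hc; have := cex_rhoV G; rewrite -{1}E.
  move: H hi; rewrite mulnDr /rho_max /rho_K1; clear; lia.
(* At most one vertex u of M now has neighbours outside R. All contacts are edges at u, so W0
   together with u would have potential at most [rho_max]; without such a u there are no contacts at
   all. *)
have Hc := contacts_le e R phi W0 C; rewrite -/M in Hc.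
have wsum : ecount e W0 M <= \sum_(u in M) w u.
  by rewrite wR (ecountC esym W0); apply: ecount_sub.
have pot0 (W : {set T}) : W \subset V -> (0 <= rho q e W)%R.
  move=> sW; have [->|W0'] := eqVneq W set0; first by rewrite rho0.
  apply: ltW; apply: le_lt_trans (cex_pot G sW W0'); rewrite /rho_max.
  have : 3 * q <= q * q by rewrite leq_mul2r q3 orbT.
  move: q3; clear; lia.
have W0V := subset_trans sW0 (subsetDl V R).
have rW0 := pot0 W0 W0V.
have q6 : 3 * q <= q * q by rewrite leq_mul2r q3 orbT.
have [/exists_inP[u uM wu]|/exists_inPn nou] := boolP [exists u in M, 0 < w u].
  have Hc' : contacts e R phi W0 C <= ecount e W0 [set u].
    apply: leq_trans Hc _; rewrite (ecountC esym) (ecountC esym W0).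
    rewrite /ecount (bigD1 u) //= big_set1 [X in _ + X]big1 ?addn0 // => v /andP[vM vu].
    have wv : w v = 0.
      apply/eqP; rewrite -leqn0 leqNgt; apply: contra nosup => wv.
      by apply/existsP; exists u; apply/existsP; exists v; rewrite uM vM eq_sym vu wu wv.
    apply/eqP; rewrite -leqn0; apply: (@leq_trans (w v)); last by rewrite wv.
    rewrite -ecount1l /w; exact: ecount_sub.
  have uR := subsetP MR _ uM.
  have dWu : [disjoint W0 & [set u]].
    by rewrite disjoint_sym disjoints1; apply/negP => /(subsetP sW0); rewrite inE uR.
  have := rhoU_le G dWu Hc'; rewrite rho1 //.
  have : (rho_max q < rho q e (W0 :|: [set u]))%R.
    apply: (cex_pot G); rewrite ?setU_eq0 ?negb_and -?card_gt0 ?cards1 ?orbT //.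
    by rewrite subUset W0V sub1set (subsetP (proper_sub pR)).
  move: H; clear; lia.
have : contacts e R phi W0 C = 0.
  apply/eqP; rewrite -leqn0 (leq_trans Hc) // (leq_trans wsum) // leqn0 sum_nat_eq0.
  by apply/forall_inP => u /nou; rewrite lt0n negbK.
move=> E; move: H rW0 q6; rewrite E muln0 /rho_max /rho_K1; move: q3; clear; lia.
Qed.

Lemma cex_Kq R : R \proper V -> 1 < #|R| -> (rho_Kq q <= rho q e R)%R.
Proof.
move=> pR R1; have [Rq|qR] := leqP #|R| q; last exact: ltW (cex_big pR qR).
by apply: rho_small; rewrite // R1.
Qed.

Lemma cex_Kq_clique R : R \proper V -> 1 < #|R| -> (rho q e R <= rho_Kq q)%R ->
  #|R| = q /\ clique e R.
Proof.
move=> pR R1 le; have [Rq|qR] := leqP #|R| q; last by have := cex_big pR qR; rewrite ltNge le.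
by apply: rho_small_clique; rewrite // R1.
Qed.

End Gap.

(** * Clusters and cliques *)

Section Extension.

Variables (q : nat) (T : finType) (e : rel T) (V : {set T}).
Hypotheses (esym : symmetric e) (eirr : irreflexive e).

Lemma extend_col1 (c : T -> 'I_q) x n : proper_col e (V :\ x) c ->
  {in V, forall z, e x z -> c z != n} -> col q e V.
Proof.
move=> pc H; apply/colP; exists (fun z => if z == x then n else c z) => y z yV zV eyz.
have [Ey|ny] := eqVneq y x; have [Ez|nz] := eqVneq z x.
- by rewrite Ey Ez eirr in eyz.
- by rewrite eq_sym H // -Ey.
- by rewrite H // -Ez esym.
by apply: pc; rewrite ?inE ?ny ?nz.
Qed.

Lemma extend_col2 (c : T -> 'I_q) x y n m : proper_col e (V :\ x :\ y) c -> n != m ->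
  {in V :\ x :\ y, forall z, e x z -> c z != n} ->
  {in V :\ x :\ y, forall z, e y z -> c z != m} -> col q e V.
Proof.
move=> pc nm Hx Hy; have [E|nxy] := eqVneq x y.
  rewrite E in pc Hx Hy; have EV : V :\ y :\ y = V :\ y.
    by apply/setP => z; rewrite !inE; case: eqP.
  rewrite EV in pc Hx; apply: (@extend_col1 c y n pc) => z zV eyz; apply: Hx => //.
  by rewrite !inE zV andbT; apply: contraTneq eyz => ->; rewrite eirr.
apply: (@extend_col1 (fun z => if z == y then m else c z) x n).
  move=> a b; rewrite !inE => /andP[ax aV] /andP[bx bV] eab.
  have [Ea|na] := eqVneq a y; have [Eb|nb] := eqVneq b y.
  - by rewrite Ea Eb eirr in eab.
  - by rewrite eq_sym Hy ?inE ?bx ?nb // -Ea.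
  - by rewrite Hy ?inE ?ax ?na // -Eb esym.
  by apply: pc; rewrite ?inE ?na ?nb ?ax ?bx.
move=> z zV exz; case: (eqVneq z y) => [_|nz]; first by rewrite eq_sym.
by apply: Hx; rewrite // !inE nz zV andbT; apply: contraTneq exz => ->; rewrite eirr.
Qed.

Lemma inj_colour (A : {set T}) : 0 < q -> #|A| <= q ->
  exists c : T -> 'I_q, {in A &, injective c}.
Proof.
move=> q0 Aq; exists (fun x => insubd (Ordinal q0) (index x (enum A))) => x y xA yA.
have h z : z \in A -> index z (enum A) < q.
  by move=> zA; apply: leq_trans Aq; rewrite cardE index_mem mem_enum.
move/(congr1 val); rewrite !val_insubd !h //; apply: (index_inj x); by rewrite mem_enum.
Qed.

End Extension.

Section Structure.

Variables (q : nat) (T : finType) (e : rel T) (V : {set T}).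
Hypothesis G : min_cex q e V.
Implicit Types (R W X Z : {set T}) (x y u v w a : T).

Let q3 := cex_q G.
Let esym := cex_sym G.
Let eirr := cex_irr G.

Definition nbhV x : {set T} := [set y in V | e x y].
Definition deg x : nat := #|nbhV x|.
Definition lowV : {set T} := [set x in V | deg x == q].
Definition cluster u : {set T} := [set w in V | cnbh e V w == cnbh e V u].
Definition qclique X : Prop := [/\ X \subset V, #|X| = q & clique e X].

Lemma cnbhE x : x \in V -> cnbh e V x = x |: nbhV x.
Proof.
by move=> xV; apply/setP => y; rewrite !inE; case: eqVneq => [->|] //=; rewrite xV.
Qed.

Lemma card_cnbh x : x \in V -> #|cnbh e V x| = (deg x).+1.
Proof. by move=> xV; rewrite cnbhE // cardsU1 inE eirr andbF. Qed.

Lemma lowV_V x : x \in lowV -> x \in V. Proof. by rewrite inE => /andP[]. Qed.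
Lemma lowV_deg x : x \in lowV -> deg x = q. Proof. by rewrite inE => /andP[_ /eqP]. Qed.

Lemma add_edges_col (F : seq (T * T)) (V' : {set T}) : V' \proper V ->
  all (fun p => p.1 != p.2) F -> (rho_max q + (2 * q * size F)%N%:Z < rho_Kq q)%R ->
  col q (add_edges e F) V'.
Proof.
move=> pV' Firr Fsmall; apply: contraT => nc.
have e'i := add_edges_irr eirr Firr.
have [|W [sW ncW rW]] := cex_min G (add_edges_sym F esym) e'i _ nc.
  by left; apply: proper_card.
have pW := sub_proper_trans sW pV'.
have W0 := ncol_neq0 (ltnW (ltnW q3)) ncW.
have [W1|W1] := ltnP 1 #|W|.
  have := cex_Kq G pW W1; have := rho_add_edges e q F W.
  have : 2 * q * count (fun p => (p.1 \in W) && (p.2 \in W)) F <= 2 * q * size F.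
    by rewrite leq_mul2l count_size orbT.
  move: rW Fsmall; clear; lia.
have /eqP/cards1P[x E] : #|W| = 1 by move: W0; rewrite -card_gt0; move: W1; clear; lia.
move: rW; rewrite E rho1 // /rho_K1 /rho_max; move: q3; clear; lia.
Qed.

(** On q + 1 vertices, a nonadjacent pair can share a colour while the others get their own; and
    K_(q+1) has potential exactly [rho_max]. *)
Lemma card_V : q.+1 < #|V|.
Proof.
rewrite ltnNge; apply/negP => Vq.
have q0 : 0 < q by lia.
have [/exists_inP[x xV /exists_inP[y yV /andP[xy nexy]]]|nex] :=
  boolP [exists x in V, [exists y in V, (x != y) && ~~ e x y]].
  have [|c ci] := @inj_colour q _ (V :\ y) q0; first by rewrite (cardsD1 y V) yV in Vq; lia.
  case/negP: (cex_ncol G); apply: (@extend_col1 q _ _ V esym eirr c y (c x)).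
    move=> a b aV bV eab; apply/negP => /eqP/(ci _ _ aV bV) E.
    by rewrite E eirr in eab.
  move=> z zV eyz; apply/negP => /eqP/ci E; case/negP: nexy; rewrite -E ?(esym z) //.
    by rewrite !inE zV andbT; apply: contraTneq eyz => ->; rewrite eirr.
  by rewrite !inE xy.
have cV : clique e V.
  move=> x y xV yV xy; apply: contraT => nexy; case/negP: nex.
  by apply/exists_inP; exists x => //; apply/exists_inP; exists y; rewrite ?xy.
have [Vq'|qV] := leqP #|V| q.
  have [c ci] := inj_colour q0 Vq'; case/negP: (cex_ncol G); apply/colP; exists c.
  move=> a b aV bV eab; apply/negP => /eqP/(ci _ _ aV bV) E.
  by rewrite E eirr in eab.
have := cex_rhoV G; rewrite rho_clique //.
have -> : #|V| = q.+1 by apply/eqP; rewrite eqn_leq Vq.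
rewrite /rho_K /rho_max; clear; lia.
Qed.

Lemma min_deg x : x \in V -> q <= deg x.
Proof.
move=> xV; rewrite leqNgt; apply/negP => lt.
have /colP[c pc] : col q e (V :\ x) by apply: (cex_crit G); apply: properD1.
have [|n] := @free_colour q (c @: nbhV x).
  exact: leq_ltn_trans (leq_imset_card _ _) lt.
move=> nN; case/negP: (cex_ncol G); apply: (extend_col1 esym eirr (c := c) (x := x) (n := n)) => //.
by move=> z zV exz; apply: contra nN => /eqP<-; apply: imset_f; rewrite inE zV.
Qed.

(* In particular G contains no K_(q+1) and no K_(q+1) minus an edge. *)
Lemma clique_out_le X a : qclique X -> a \in V -> a \notin X ->
  2 * ecount e [set a] X <= q.
Proof.
case=> sX Xq cX aV aX; rewrite leqNgt; apply/negP => lt.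
have qX : #|a |: X| = q.+1 by rewrite cardsU1 aX Xq.
have sR : a |: X \subset V by rewrite subUset sub1set aV.
have pR : a |: X \proper V.
  by apply: cex_proper => //; apply: contraTneq card_V => <-; rewrite qX ltnn.
have := cex_big G pR; rewrite qX => /(_ (ltnSn q)); rewrite rhoU1 // rho_Kq_clique //.
have : q * q.+1 <= q * (2 * ecount e [set a] X) by rewrite leq_mul2l lt orbT.
rewrite /rho_Kq /rho_K1; clear; lia.
Qed.

Lemma nbhV_clique X v : qclique X -> v \in X -> nbhV v :&: X = X :\ v.
Proof.
case=> sX _ cX vX; apply/setP => z; rewrite !inE.
case: (boolP (z \in X)) => zX; rewrite ?andbF ?andbT //.
rewrite (subsetP sX) //=; case: eqVneq => [->|zv]; first by rewrite eirr.
by rewrite cX // eq_sym.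
Qed.

Lemma card_clique_out X v : qclique X -> v \in X -> #|nbhV v :\: X| + q = (deg v).+1.
Proof.
move=> kX vX; have [_ Xq _] := kX.
have := cardsID X (nbhV v); rewrite nbhV_clique // -/(deg v).
have := cardsD1 v X; rewrite vX Xq; clear; lia.
Qed.

Lemma clique_cnbh X u : qclique X -> u \in X -> X \subset cnbh e V u.
Proof.
case=> sX _ cX uX; apply/subsetP => x xX; rewrite !inE (subsetP sX _ xX) /=.
by case: eqVneq => //= xu; apply: cX; rewrite // eq_sym.
Qed.

Lemma clique_outer X u : qclique X -> u \in X -> u \in lowV ->
  exists a, [/\ a \in V, a \notin X, e u a & cnbh e V u = a |: X].
Proof.
move=> kX uX uD; have sX := clique_cnbh kX uX; have [sXV Xq cX] := kX.
have uV := lowV_V uD.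
have : #|cnbh e V u :\: X| = 1.
  have := cardsID X (cnbh e V u); rewrite (setIidPr sX) card_cnbh // lowV_deg // Xq.
  by clear; lia.
move/eqP/cards1P => [a Ea]; exists a.
have : a \in cnbh e V u :\: X by rewrite Ea set11.
rewrite !inE => /and3P[aX aV /orP[/eqP E|eua]]; first by rewrite E uX in aX.
split=> //; rewrite -(setID (cnbh e V u) X) (setIidPr sX) Ea.
by rewrite setUC.
Qed.

(* If the outer neighbours a and b of u and w differ, a colouring of G - u - w
   with distinct colours on a and b extends to u and w. *)
Lemma clique_low_twins X u w : qclique X -> u \in X -> w \in X ->
  u \in lowV -> w \in lowV -> cnbh e V u = cnbh e V w.
Proof.
move=> kX uX wX uD wD; have [sXV Xq cX] := kX.
have [a [aV aX eua Ea]] := clique_outer kX uX uD.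
have [b [bV bX ewb Eb]] := clique_outer kX wX wD.
rewrite Ea Eb; have [->//|ab] := eqVneq a b.
have [E|uw] := eqVneq u w; first by rewrite -Ea -Eb E.
have uV := lowV_V uD; have wV := lowV_V wD.
pose e' := add_edges e [:: (a, b)]; pose V' := V :\ u :\ w.
have V'V : V' \subset V by apply/subsetP => z; rewrite !inE => /and3P[].
have inV' z : z \in V -> z \notin X -> z \in V'.
  move=> zV zX; rewrite !inE zV andbT; apply/andP; split.
    by apply: contraNneq zX => ->.
  by apply: contraNneq zX => ->.
case/negP: (cex_ncol G).
have /colP[c pc] : col q e' V'.
  apply: add_edges_col; rewrite /= ?ab //.
    by apply/properP; split=> //; exists w; rewrite // !inE eqxx.
  have : 3 * q <= q * q by rewrite leq_mul2r q3 orbT.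
  rewrite /rho_max /rho_Kq; move: q3; clear; lia.
have pc' : proper_col e V' c by apply: col_add_edges pc.
have cab : c a != c b.
  by apply: pc; rewrite ?inV' // /e' /add_edges /= !eqxx orbT.
pose Z := X :\ u :\ w; pose Fr := ~: (c @: Z).
have Fr2 : 1 < #|Fr|.
  have := leq_imset_card c Z; have := cardsC (c @: Z); rewrite card_ord -/Fr.
  have := cardsD1 u X; have := cardsD1 w (X :\ u); rewrite !inE uX wX eq_sym uw -/Z Xq /=.
  clear; lia.
have NX t d z : cnbh e V t = d |: X -> z \in V' -> e t z -> (z == d) || (z \in Z).
  move=> Et zV' etz; have zV := subsetP V'V _ zV'.
  have : z \in cnbh e V t by rewrite inE zV etz orbT.
  rewrite Et !inE; move: zV'; rewrite !inE => /and3P[-> -> _]; rewrite /=.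
  by [].
(* If the colour of a is free, w takes it, which is allowed because a and b differ, and u takes
   another free colour. If it is not free, u cannot clash with a, and only m has to avoid the colour
   of b. *)
have [n [m [nF mF nm na mb]]] : exists n m, [/\ n \in Fr, m \in Fr, n != m, n != c a & m != c b].
  have [aF|aF] := boolP (c a \in Fr).
    have /card_gt0P[n] : 0 < #|Fr :\ c a| by rewrite (cardsD1 (c a)) aF in Fr2.
    by rewrite in_setD1 => /andP[na nF]; exists n, (c a).
  have /card_gt0P[m] : 0 < #|Fr :\ c b|.
    by move: Fr2; rewrite (cardsD1 (c b)); case: (_ \in _) => //=; clear; lia.
  rewrite in_setD1 => /andP[mb mF].
  have /card_gt0P[n] : 0 < #|Fr :\ m| by rewrite (cardsD1 m) mF in Fr2.
  rewrite in_setD1 => /andP[nm nF]; exists n, m; split=> //.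
  by apply: contraNneq aF => <-.
have Frz z n0 : n0 \in Fr -> z \in Z -> c z != n0.
  by rewrite inE => n0F zZ; apply: contraNneq n0F => <-; apply: imset_f.
apply: (extend_col2 esym eirr (c := c) (x := u) (y := w) (n := n) (m := m)) => // z zV' ez.
  by have /orP[/eqP->|zZ] := NX _ _ _ Ea zV' ez; rewrite ?(Frz z) // eq_sym.
by have /orP[/eqP->|zZ] := NX _ _ _ Eb zV' ez; rewrite ?(Frz z) // eq_sym.
Qed.

Lemma mem_cluster u : u \in V -> u \in cluster u.
Proof. by move=> uV; rewrite inE uV eqxx. Qed.

Lemma clusterP u w : w \in cluster u -> w \in V /\ cnbh e V w = cnbh e V u.
Proof. by rewrite inE => /andP[-> /eqP]. Qed.

Lemma cluster_eq u w : w \in cluster u -> cluster w = cluster u.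
Proof. by case/clusterP => _ E; apply/setP => z; rewrite !inE E. Qed.

Lemma cluster_low u w : u \in lowV -> w \in cluster u -> w \in lowV.
Proof.
move=> uD /clusterP[wV E]; rewrite inE wV -eqSS -card_cnbh // E card_cnbh; last exact: lowV_V.
by rewrite (lowV_deg uD) /= eqxx.
Qed.

(** A twin of u outside X would be adjacent to all of X, against [clique_out_le]. *)
Lemma clique_cluster X u : qclique X -> u \in X -> u \in lowV -> cluster u = X :&: lowV.
Proof.
move=> kX uX uD; have [sX Xq cX] := kX; apply/setP => w; apply/idP/setIP => [wu|[wX wD]].
  have wD := cluster_low uD wu; split=> //; have [wV E] := clusterP wu.
  apply: contraT => wX; have := clique_out_le kX wV wX.
  have : ecount e [set w] X = q; last by move->; move: q3; clear; lia.
  rewrite ecount1 -Xq; apply: eq_card => x; rewrite inE.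
  case: (boolP (x \in X)) => //= xX; have := subsetP (clique_cnbh kX uX) _ xX.
  by rewrite -E inE => /andP[_ /orP[/eqP Exw|//]]; rewrite -Exw xX in wX.
by rewrite inE (subsetP sX) //= (clique_low_twins kX wX uX).
Qed.

(** The common outer neighbour of the cluster sees at most half of X. *)
Lemma clique_cluster_le X u : qclique X -> u \in X -> u \in lowV -> 2 * #|cluster u| <= q.
Proof.
move=> kX uX uD; have [a [aV aX eua Ea]] := clique_outer kX uX uD.
apply: leq_trans (clique_out_le kX aV aX); rewrite leq_mul2l /= ecount1.
apply: subset_leq_card; apply/subsetP => w wu; rewrite inE.
have := wu; rewrite (clique_cluster kX uX uD) inE => /andP[wX _]; rewrite wX /=.
have [wV E] := clusterP wu; have : a \in cnbh e V w by rewrite E Ea setU11.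
by rewrite inE esym => /andP[_ /orP[/eqP Eaw|//]]; rewrite Eaw wX in aX.
Qed.

Lemma cluster_clique u : u \in V -> clique e (cluster u).
Proof.
move=> uV x y xu yu xy; have [xV Ex] := clusterP xu; have [yV Ey] := clusterP yu.
have : y \in cnbh e V x by rewrite Ex -Ey inE yV eqxx.
by rewrite inE eq_sym (negbTE xy) => /andP[].
Qed.

End Structure.

(** * Replacing a vertex by a twin of its neighbour *)

Section TwinGraph.

Variables (T : finType) (e : rel T) (u v : T).
Hypotheses (esym : symmetric e) (eirr : irreflexive e).

(* The edges at v are replaced so that v becomes an adjacent twin of u. *)
Definition twin : rel T := fun x y =>
  if x == v then (y != v) && ((y == u) || e u y)
  else if y == v then (x == u) || e u x else e x y.

Lemma twin_sym : symmetric twin.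
Proof.
move=> x y; rewrite /twin; case: (eqVneq x v) => [Ex|xv]; case: (eqVneq y v) => [Ey|yv] //=.
Qed.

Lemma twin_irr : irreflexive twin.
Proof. by move=> x; rewrite /twin; case: eqVneq => [->|]; rewrite ?eqxx ?eirr. Qed.

Lemma twin_v y : y != v -> twin v y = (y == u) || e u y.
Proof. by rewrite /twin eqxx => ->. Qed.

Lemma twin_old x y : x != v -> y != v -> twin x y = e x y.
Proof. by rewrite /twin => /negbTE-> /negbTE->. Qed.

End TwinGraph.

Section Twins.

Variables (q : nat) (T : finType) (e : rel T) (V : {set T}).
Hypothesis G : min_cex q e V.
Implicit Types (R W X Z : {set T}) (x y u v w a : T).

Let q3 := cex_q G.
Let esym := cex_sym G.
Let eirr := cex_irr G.

Let clusterP := (@clusterP T e V).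

Section Replacement.

Variables (u v : T).
Hypotheses (uD : u \in lowV q e V) (vV : v \in V) (euv : e u v).
Hypotheses (vu : v \notin cluster e V u) (degv : deg e V v < q + #|cluster e V u|).

Let uV := lowV_V uD.
Let e' := twin e u v.

(** Fewer than q neighbours of v lie outside the cluster K of u, so some colour n is missing on
    them. In a colouring of the twin graph, the vertex of K coloured n, if any, can take the colour
    of the new v, being its twin; then n is free for the old v. *)
Lemma twin_ncol : ~~ col q e' V.
Proof.
apply: contra (cex_ncol G) => /colP[c pc].
pose K := cluster e V u.
have KP w : w \in K -> [/\ w \in V, w != v & forall z, z \in V -> (z == w) || e w z = (z == u) || e u z].
  move=> wK; have [wV E] := clusterP wK; split=> // [|z zV].
    by apply: contraNneq vu => <-.
  by have /setP/(_ z) := E; rewrite !inE zV.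
have KN : K \subset nbhV e V v.
  apply/subsetP => w wK; have [wV wv H] := KP w wK; rewrite inE wV esym /=.
  by have := H v vV; rewrite euv orbT eq_sym (negbTE wv).
have [n nN] : exists n, n \notin c @: (nbhV e V v :\: K).
  apply: free_colour; apply: leq_ltn_trans (leq_imset_card _ _) _.
  have := cardsID K (nbhV e V v); rewrite (setIidPr KN) -/(deg e V v).
  by move: degv; rewrite -/K; clear; lia.
have cv z : z \in V -> z != v -> (z == u) || e u z -> c v != c z.
  by move=> zV zv H; apply: pc => //; rewrite /e' twin_v.
have co x y : x \in V -> y \in V -> x != v -> y != v -> e x y -> c x != c y.
  by move=> xV yV xv yv exy; apply: pc => //; rewrite /e' twin_old.
have cK w : w \in K -> c v != c w.
  move=> wK; have [wV wv H] := KP w wK; apply: cv => //; rewrite -H ?eqxx //.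
apply/colP; exists (fun z => if z == v then n else if (z \in K) && (c z == n) then c v else c z).
have main x y : x \in V -> y \in V -> e x y -> y != v ->
    (if x == v then n else if (x \in K) && (c x == n) then c v else c x) !=
    (if (y \in K) && (c y == n) then c v else c y).
  move=> xV yV exy yv; have [Ex|xv] := eqVneq x v.
    have [yK|yK] := boolP (y \in K) => /=.
      case: (eqVneq (c y) n) => [<-|]; last by rewrite eq_sym.
      by rewrite eq_sym cK.
    apply: contraNneq nN => ->; apply: imset_f; by rewrite in_setD yK inE yV -Ex exy.
  case: (boolP (x \in K)) => xK; case: (boolP (y \in K)) => yK /=.
  - case: (eqVneq (c x) n) => Ecx; case: (eqVneq (c y) n) => Ecy; last exact: co.
    + by move: (co _ _ xV yV xv yv exy); rewrite Ecx Ecy eqxx.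
    + exact: cK.
    by rewrite eq_sym cK.
  - case: (eqVneq (c x) n) => Ecx; last exact: co.
    by have [_ _ H] := KP x xK; apply: cv => //; rewrite -H // exy orbT.
  - case: (eqVneq (c y) n) => Ecy; last exact: co.
    have [_ _ H] := KP y yK; rewrite eq_sym; apply: cv => //.
    by rewrite -H // esym exy orbT.
  exact: co.
move=> x y xV yV exy; have [Ey|yv] := eqVneq y v; last exact: main.
have [Ex|xv] := eqVneq x v; first by rewrite Ex Ey eirr in exy.
by rewrite eq_sym; have := main y x yV xV; rewrite esym exy Ey eqxx => /(_ isT); apply.
Qed.

Lemma twin_row : ecount e' [set v] (V :\ v) = q.
Proof.
rewrite ecount1 -[RHS](lowV_deg uD).
have -> : deg e V u = #|cnbh e V u :\ v|.
  have := cardsD1 v (cnbh e V u); rewrite (card_cnbh G) // inE vV euv orbT /=.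
  by clear; lia.
apply: eq_card => y; rewrite !inE; case: (eqVneq y v) => //= yv.
by rewrite /e' twin_v.
Qed.

Lemma twin_old_count (A : {set T}) : v \notin A -> ecount e' A A = ecount e A A.
Proof.
move=> vA; apply: eq_in_ecount => x y xA yA; rewrite /e' twin_old //.
  by apply: contraNneq vA => <-.
by apply: contraNneq vA => <-.
Qed.

Lemma ecount_split (f : rel T) : symmetric f -> f v v = false ->
  ecount f V V = ecount f (V :\ v) (V :\ v) + 2 * ecount f [set v] (V :\ v).
Proof.
move=> fs fv; rewrite -{1 2}(setD1K vV) ecountUU //; last first.
  by rewrite disjoints1 !inE eqxx.
by rewrite ecount1l big_set1 fv.
Qed.

Lemma row_deg x : x \in V -> ecount e [set x] (V :\ x) = deg e V x.
Proof.
move=> xV; rewrite ecount1; apply: eq_card => y; rewrite !inE.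
by case: eqVneq => //= ->; rewrite eirr andbF.
Qed.

Lemma twin_ecount : ecount e' V V + 2 * deg e V v = ecount e V V + 2 * q.
Proof.
rewrite (ecount_split esym) ?eirr // (@ecount_split e'); first last.
- exact: twin_irr.
- exact: twin_sym.
rewrite twin_row twin_old_count ?row_deg //; first by clear; lia.
by rewrite !inE eqxx.
Qed.

(** The vertex v loses fewer than |cluster v| twins and gains the whole cluster of u. Pairs of twins
    not involving v survive, as twins agree on adjacency to u and hence to the new v. *)
Lemma twin_ntwins : #|cluster e V v| <= #|cluster e V u| -> ntwins e V < ntwins e' V.
Proof.
move=> le; pose tw (f : rel T) : rel T := fun x y => cnbh f V x == cnbh f V y.
have split f : ntwins f V = 1 + ecount (tw f) (V :\ v) (V :\ v) + 2 * ecount (tw f) [set v] (V :\ v).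
  rewrite /ntwins -/(ecount (tw f) V V) -{1 2}(setD1K vV) ecountUU; last first.
  - by rewrite disjoints1 !inE eqxx.
  - by move=> x y; rewrite /tw eq_sym.
  by rewrite ecount1l big_set1 /tw eqxx.
rewrite !split.
have E1 : ecount (tw e) [set v] (V :\ v) < #|cluster e V v|.
  rewrite ecount1 (cardsD1 v (cluster e V v)) mem_cluster //= ltnS.
  apply: subset_leq_card; apply/subsetP => y; rewrite !inE /tw => /andP[/andP[-> ->]].
  by rewrite eq_sym.
have ce' x z : x != v -> z \in V -> (z \in cnbh e' V x) =
    if z == v then (x == u) || e u x else (z \in cnbh e V x).
  move=> xv zV; rewrite !inE zV /=; case: (eqVneq z v) => [->|zv].
    by rewrite /e' twin_sym ?twin_v // eq_sym (negbTE xv).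
  by rewrite /e' twin_old.
have E2 : #|cluster e V u| <= ecount (tw e') [set v] (V :\ v).
  rewrite ecount1; apply: subset_leq_card; apply/subsetP => w wu.
  have [wV Ew] := clusterP wu.
  have wv : w != v by apply: contraNneq vu => <-.
  rewrite !inE wv wV /=; apply/eqP/setP => z.
  case: (boolP (z \in V)) => [zV|zV]; last by rewrite !inE (negbTE zV).
  rewrite [RHS]ce' // !inE zV /=; case: (eqVneq z v) => [->|zv] /=.
    have : w \in cnbh e V u by rewrite -Ew inE wV eqxx.
    by rewrite inE wV /= => ->.
  rewrite /e' twin_v //; have : (z \in cnbh e V u) = (z \in cnbh e V w) by rewrite Ew.
  by rewrite !inE zV.
have E3 : ecount (tw e) (V :\ v) (V :\ v) <= ecount (tw e') (V :\ v) (V :\ v).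
  apply: leq_sum => x xV; apply: leq_sum => y yV.
  case: (boolP (tw e x y)) => //= /eqP E; rewrite lt0b; apply/eqP/setP => z.
  move: xV yV; rewrite !in_setD1 => /andP[xv xV] /andP[yv yV].
  case: (boolP (z \in V)) => [zV|zV]; last by rewrite !inE (negbTE zV).
  rewrite !ce' // E; case: ifP => // _.
  have : (u \in cnbh e V x) = (u \in cnbh e V y) by rewrite E.
  by rewrite !inE uV /= eq_sym (eq_sym u) !(esym _ u).
move: E1 E2 E3 le; clear; lia.
Qed.

(* A dense subgraph of the twin graph contains u and v; without v it becomes a
   set of potential at most rho_Kq of the original graph. *)
Lemma twin_clique : (q < deg e V v) || (#|cluster e V v| <= #|cluster e V u|) ->
  exists Z, [/\ qclique q e V Z, u \in Z & v \notin Z].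
Proof.
move=> H; have Evc := twin_ecount.
have sm : smaller e' V e V.
  right; split=> //; have [lt|ge] := ltnP q (deg e V v).
    by left; move: Evc lt; clear; lia.
  have dq : deg e V v = q by apply/eqP; rewrite eqn_leq ge (min_deg G vV).
  right; split; first by move: Evc; rewrite dq; clear; lia.
  by apply: twin_ntwins; move: H; rewrite ltnNge ge.
have [W [sW ncW rW]] := cex_min G (twin_sym u v esym) (twin_irr u v eirr) sm twin_ncol.
rewrite -/e' in rW.
have W0 := ncol_neq0 (ltnW (ltnW q3)) ncW.
have vW : v \in W.
  apply: contraT => vW; have := cex_pot G sW W0.
  by rewrite ltNge -(_ : rho q e' W = rho q e W) ?rW // /rho twin_old_count.
have WvV : W :\ v \subset V by apply: subset_trans sW; apply: subsetDl.
have WE := setD1K vW.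
have e's : symmetric e' by apply: twin_sym.
have e'i : irreflexive e' by apply: twin_irr.
have rWE : (rho q e' W = rho q e (W :\ v) + rho_K1 q - (2 * q * ecount e' [set v] (W :\ v))%N%:Z)%R.
  rewrite -{1}WE rhoU1 ?inE ?eqxx //; congr (_ + _ - _)%R.
  by rewrite /rho twin_old_count // !inE eqxx.
have uv : u != v by apply: contraTneq euv => ->; rewrite eirr.
(* If u were not in W, exchanging v for u would give a set of the same potential in G. *)
have uW : u \in W.
  apply: contraT => uW.
  have sub : u |: (W :\ v) \subset V by rewrite subUset sub1set uV.
  have ne : u |: (W :\ v) != set0 by apply/set0Pn; exists u; rewrite setU11.
  have := cex_pot G sub ne; rewrite rhoU1 ?inE ?(negbTE uW) ?andbF //.
  have : ecount e' [set v] (W :\ v) = ecount e [set u] (W :\ v).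
    rewrite !ecount1l; apply: eq_bigr => y; rewrite !inE => /andP[yv yW].
    rewrite /e' twin_v //; case: eqVneq => // Ey; by rewrite -Ey yW in uW.
  by move=> <-; rewrite -rWE ltNge rW.
have rle : ecount e' [set v] (W :\ v) <= q.
  rewrite -[X in _ <= X]twin_row; apply: ecount_sub => //; exact: setSD.
(* The new v has at most q neighbours in W, and rho_max - rho_K1 + 2q * q = rho_Kq. *)
have rWv : (rho q e (W :\ v) <= rho_Kq q)%R.
  have : 2 * q * ecount e' [set v] (W :\ v) <= 2 * q * q by rewrite leq_mul2l rle orbT.
  move: rWE rW; rewrite /rho_Kq /rho_max /rho_K1; clear; lia.
have pW : W :\ v \proper V.
  apply/properP; split=> //; exists v; rewrite // !inE eqxx //.
have Wv1 : 1 < #|W :\ v|.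
  rewrite ltnNge; apply/negP => le1.
  have : W :\ v = [set u].
    apply/eqP; rewrite eq_sym eqEcard sub1set !inE uv uW cards1; exact: le1.
  move=> Wvu; move: rWE rW; rewrite Wvu rho1 //.
  have : ecount e' [set v] [set u] <= 1 by rewrite ecount1l big_set1 leq_b1.
  move=> h; have : 2 * q * ecount e' [set v] [set u] <= 2 * q * 1 by rewrite leq_mul2l h orbT.
  have : 3 * q <= q * q by rewrite leq_mul2r q3 orbT.
  rewrite /rho_max /rho_K1; move: q3; clear; lia.
have [cq cc] := cex_Kq_clique G pW Wv1 rWv.
by exists (W :\ v); split=> //; rewrite !inE ?uv ?uW ?eqxx.
Qed.

End Replacement.

End Twins.

Section Neighbours.

Variables (q : nat) (T : finType) (e : rel T) (V : {set T}).
Hypothesis G : min_cex q e V.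
Implicit Types (R W X Z : {set T}) (x y u v w a : T).

Let q3 := cex_q G.
Let esym := cex_sym G.
Let eirr := cex_irr G.

Local Notation deg := (deg e V).
Local Notation lowV := (lowV q e V).
Local Notation cluster := (cluster e V).
Local Notation qclique := (qclique q e V).

Lemma cnbh_out u w v : v \in V -> e u v -> v \notin cluster u -> w \in cluster u -> e w v.
Proof.
move=> vV euv vu wu; have [wV E] := clusterP wu.
have : v \in cnbh e V w by rewrite E inE vV euv orbT.
by rewrite inE vV /= => /orP[/eqP Ev|//]; rewrite Ev wu in vu.
Qed.

(* The larger of two adjacent clusters lies in a q-clique, so the smaller one
   is a singleton. *)
Lemma low_nbr_cluster_le u v : u \in lowV -> 1 < #|cluster u| -> v \in V -> e u v ->
  v \notin cluster u -> v \in lowV -> #|cluster v| <= #|cluster u|.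
Proof.
move=> uD cu vV euv vu vD; rewrite leqNgt; apply/negP => lt.
have uV := lowV_V uD.
have evu : e v u by rewrite esym.
have uv : u \notin cluster v.
  by apply: contra vu => /cluster_eq ->; apply: mem_cluster.
have degu : deg u < q + #|cluster v| by rewrite (lowV_deg uD); move: lt; clear; lia.
have [|Z [kZ vZ uZ]] := twin_clique G vD uV evu uv degu; first by rewrite (ltnW lt) orbT.
have [sZ Zq cZ] := kZ.
have /card_gt0P[u'] : 0 < #|cluster u :\ u|.
  by move: cu; rewrite (cardsD1 u) mem_cluster.
rewrite in_setD1 => /andP[u'u u'C]; have [u'V Eu'] := clusterP u'C.
have u'v := cnbh_out vV euv vu u'C.
have [a [aV aZ eva Ea]] := clique_outer G kZ vZ vD.
have Eua : u = a.
  have : u \in a |: Z by rewrite -Ea inE uV evu orbT.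
  by rewrite !inE (negbTE uZ) orbF => /eqP.
have u'Z : u' \in Z.
  have : u' \in a |: Z by rewrite -Ea inE u'V (esym v) u'v orbT.
  by rewrite -Eua !inE (negbTE u'u).
have := clique_out_le G kZ uV uZ.
suff -> : ecount e [set u] Z = q by move: q3; clear; lia.
rewrite ecount1 -Zq; apply: eq_card => x; rewrite inE.
case: (boolP (x \in Z)) => //= xZ; have := subsetP (clique_cnbh kZ u'Z) _ xZ.
by rewrite Eu' inE => /andP[_ /orP[/eqP Exu|//]]; rewrite -Exu xZ in uZ.
Qed.

(** Otherwise [twin_clique] gives a q-clique Z through u that avoids v. If u and v share a q-clique
    X, then Z is X with v exchanged for the outer neighbour a of u, so a has q - 1 neighbours in X,
    against [clique_out_le]. *)
Lemma cluster_nbr_deg u v : u \in lowV -> 1 < #|cluster u| -> v \in V -> e u v ->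
  v \notin cluster u ->
  (forall X, qclique X -> u \notin X) \/ (exists X, [/\ qclique X, u \in X & v \in X]) ->
  q + #|cluster u| <= deg v.
Proof.
move=> uD cu vV euv vu hyp; rewrite leqNgt; apply/negP => degv.
have [|Z [kZ uZ vZ]] := twin_clique G uD vV euv vu degv.
  have [//|qv] := ltnP q (deg v); rewrite low_nbr_cluster_le // inE vV.
  by rewrite eqn_leq qv (min_deg G).
case: hyp => [/(_ Z kZ)/negP//|[X [kX uX vX]]].
have [sX Xq cX] := kX; have [sZ Zq cZ] := kZ.
have [a [aV aX eua Ea]] := clique_outer G kX uX uD.
have ZE : Z = (a |: X) :\ v.
  apply/eqP; rewrite eqEcard subsetD1 vZ andbT -Ea (clique_cnbh kZ uZ) /= Zq.
  have := cardsD1 v (a |: X); rewrite !inE vX orbT cardsU1 aX Xq Ea; clear; lia.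
have aZ : a \in Z by rewrite ZE !inE eqxx andbT; apply: contraNneq aX => ->.
have := clique_out_le G kX aV aX.
have : #|X :\ v| <= ecount e [set a] X.
  rewrite ecount1; apply: subset_leq_card; apply/subsetP => x.
  rewrite !inE => /andP[xv xX]; rewrite xX /=; apply: cZ => //.
    by rewrite ZE !inE xv xX orbT.
  by apply: contraNneq aX => ->.
have := cardsD1 v X; rewrite vX Xq; move: q3; clear; lia.
Qed.

(** Here u is the vertex to be replaced by a twin of y; its cluster, a singleton, is no larger than
    that of y. *)
Lemma single_low_nbr u y : u \in lowV -> #|cluster u| = 1 -> y \in lowV -> e u y ->
  exists Z, [/\ qclique Z, y \in Z & u \notin Z].
Proof.
move=> uD cu yD euy; have uV := lowV_V uD; have yV := lowV_V yD.
have ne : u != y by apply: contraTneq euy => ->; rewrite eirr.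
have cy : 0 < #|cluster y| by apply/card_gt0P; exists y; apply: mem_cluster.
apply: (twin_clique G yD uV); rewrite ?cu ?cy ?orbT //; first by rewrite esym.
  apply/negP => uy; have := cluster_eq uy => E.
  have : #|[set u; y]| <= #|cluster u|.
    by apply: subset_leq_card; rewrite subUset !sub1set mem_cluster // E mem_cluster.
  by rewrite cards2 ne cu.
by rewrite (lowV_deg uD); move: cy; clear; lia.
Qed.

(* If w were not adjacent to a, then after adding edges from a to the two outer
   neighbours of w, the colour missing on X could be moved to w. *)
Lemma clique_degS_adj X u a w : 5 <= q -> qclique X -> u \in X -> u \in lowV ->
  cnbh e V u = a |: X -> a \in V -> a \notin X -> w \in X -> deg w = q.+1 -> e a w.
Proof.
move=> q5 kX uX uD Ea aV aX wX dw; apply: contraT => naw.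
have [sX Xq cX] := kX; have uV := lowV_V uD; have wV := subsetP sX _ wX.
have uw : u != w.
  by apply: contra_eqN dw => /eqP<-; rewrite (lowV_deg uD) neq_ltn ltnSn.
have O2 : #|nbhV e V w :\: X| = 2.
  have := card_clique_out G kX wX; rewrite dw; clear; lia.
have /cards2P[b [d [bd Obd]]] : #|nbhV e V w :\: X| == 2 by rewrite O2.
have inO z : (z \in nbhV e V w :\: X) = (z == b) || (z == d) by rewrite Obd !inE.
have ewb : e w b by have := inO b; rewrite eqxx !inE => /and3P[].
have ewd : e w d by have := inO d; rewrite eqxx orbT !inE => /and3P[].
have bX : b \notin X by have := inO b; rewrite eqxx !inE => /and3P[].
have dX : d \notin X by have := inO d; rewrite eqxx orbT !inE => /and3P[].
have bV : b \in V by have := inO b; rewrite eqxx !inE => /and3P[].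
have dV : d \in V by have := inO d; rewrite eqxx orbT !inE => /and3P[].
have ab : a != b by apply: contraNneq naw => ->; rewrite esym.
have ad : a != d by apply: contraNneq naw => ->; rewrite esym.
have /colP[c pc'] : col q (add_edges e [:: (a, b); (a, d)]) (V :\ u).
  apply: (add_edges_col G); rewrite /= ?ab ?ad //; first exact: properD1.
  have : 5 * q <= q * q by rewrite leq_mul2r q5 orbT.
  rewrite /rho_max /rho_Kq; move: q5; clear; lia.
have pc := col_add_edges pc'.
have inU z : z \in V -> z \notin X -> z \in V :\ u.
  by move=> zV zX; rewrite !inE zV andbT; apply: contraNneq zX => ->.
have cab : c a != c b by apply: pc'; rewrite ?inU // /add_edges /= !eqxx orbT.
have cad : c a != c d by apply: pc'; rewrite ?inU // /add_edges /= !eqxx !orbT.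
case/negP: (cex_ncol G).
have Nu : #|nbhV e V u| = q := lowV_deg uD.
(* A repeated colour on the neighbours of u leaves one for u. Otherwise their q colours are
   distinct: u takes the colour of w, and w that of a, which the added edges keep off b and d. *)
have [lt|ge] := ltnP #|c @: nbhV e V u| q.
  have [n nN] := free_colour lt; apply: (extend_col1 esym eirr (n := n) pc).
  by move=> z zV euz; apply: contra nN => /eqP<-; apply: imset_f; rewrite inE zV.
have ci : {in nbhV e V u &, injective c}.
  by apply/imset_injP; rewrite eqn_leq leq_imset_card Nu.
have uN z : z \in V -> e u z -> z \in nbhV e V u by move=> zV euz; rewrite inE zV.
have XN z : z \in X -> z != u -> z \in nbhV e V u.
  by move=> zX zu; apply: uN; rewrite ?(subsetP sX) //; apply: cX; rewrite // eq_sym.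
have eua : e u a.
  have : a \in cnbh e V u by rewrite Ea setU11.
  by rewrite inE => /andP[_ /orP[/eqP E|//]]; rewrite E uX in aX.
have cne y z : y \in nbhV e V u -> z \in nbhV e V u -> y != z -> c y != c z.
  by move=> yN zN; apply: contra_neq => E; apply: ci.
have wN : w \in nbhV e V u by apply: XN; rewrite // eq_sym.
have aw : a != w by apply: contraNneq aX => ->.
apply: (extend_col2 esym eirr (c := c) (x := u) (y := w) (n := c w) (m := c a)).
- by move=> y z; rewrite !inE => /and3P[_ yu yV] /and3P[_ zu zV]; apply: pc; rewrite !inE ?yu ?zu.
- by apply: cne => //; [apply: uN|rewrite eq_sym].
- move=> z; rewrite !inE => /and3P[zw zu zV] euz; apply: cne => //; exact: uN.
move=> z; rewrite !inE => /and3P[zw zu zV] ewz.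
case: (boolP (z \in X)) => zX.
  by apply: cne; [apply: XN|apply: uN|apply: contraNneq aX => <-].
have : z \in nbhV e V w :\: X by rewrite !inE zX zV.
by rewrite inO => /orP[/eqP->|/eqP->]; rewrite eq_sym.
Qed.

End Neighbours.

(** * Vertices of degree q in q-cliques for q at most 4 *)

Section Identification.

Variables (T : finType) (e : rel T) (x a : T).
Hypotheses (esym : symmetric e) (eirr : irreflexive e).

(* x also receives the neighbours of a, as if a were identified with x. *)
Definition absorb : rel T := fun y z => [|| e y z, (y == x) && e a z | (z == x) && e a y].

Lemma absorb_sym : symmetric absorb.
Proof. by move=> y z; rewrite /absorb esym; congr (_ || _); apply: orbC. Qed.

Lemma absorb_irr : ~~ e a x -> irreflexive absorb.
Proof. by move=> nax y; rewrite /absorb eirr orbb; case: eqVneq => //= ->; apply: negbTE. Qed.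

Lemma absorb_out (W : {set T}) : x \notin W -> ecount absorb W W = ecount e W W.
Proof.
move=> xW; apply: eq_in_ecount => y z yW zW; rewrite /absorb.
have -> : (y == x) = false by apply: contraNF xW => /eqP<-.
by have -> : (z == x) = false by [apply: contraNF xW => /eqP<-]; rewrite orbF.
Qed.

(** Common neighbours of a and x make the inequality strict. *)
Lemma ecount_absorb (W : {set T}) : ~~ e a x -> x \in W ->
  ecount absorb W W <= ecount e W W + 2 * ecount e [set a] W.
Proof.
move=> nax xW; rewrite -(setD1K xW).
have d : [disjoint [set x] & W :\ x] by rewrite disjoints1 !inE eqxx.
rewrite !ecountUU //; last exact: absorb_sym.
rewrite ecount11; last exact: absorb_irr.
rewrite ecount11 // absorb_out; last by rewrite !inE eqxx.
have -> : ecount e [set a] (x |: W :\ x) = ecount e [set a] (W :\ x).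
  by rewrite ecountUr // ecount1l big_set1 (negbTE nax).
suff : ecount absorb [set x] (W :\ x) <= ecount e [set x] (W :\ x) + ecount e [set a] (W :\ x).
  by clear; lia.
rewrite !ecount1l -big_split /=; apply: leq_sum => y; rewrite !inE => /andP[yx yW].
by rewrite /absorb eqxx (negbTE yx) /= orbF; case: (e x y); case: (e a y).
Qed.

End Identification.

Section SmallCliques.

Variables (q : nat) (T : finType) (e : rel T) (V : {set T}).
Hypothesis G : min_cex q e V.
Hypothesis q4 : q <= 4.
Implicit Types (R W X Z : {set T}) (x y u v w a : T).

Let q3 := cex_q G.
Let esym := cex_sym G.
Let eirr := cex_irr G.

Local Notation deg := (deg e V).
Local Notation lowV := (lowV q e V).
Local Notation cluster := (cluster e V).
Local Notation qclique := (qclique q e V).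

(* If cluster u = {u, w}, then in every colouring of G - u - w the colours of
   a and of the two other vertices of X are distinct; so identifying a with one
   of these vertices leaves an uncolourable graph. *)
Lemma clique_low_single X u : qclique X -> u \in X -> u \in lowV -> #|cluster u| = 1.
Proof.
move=> kX uX uD; have uV := lowV_V uD.
have cle := clique_cluster_le G kX uX uD.
have cu : u \in cluster u := mem_cluster e uV.
have c0 : 0 < #|cluster u| by apply/card_gt0P; exists u.
(* By [clique_cluster_le] only q = 4 with a cluster of two vertices remains to be excluded. *)
have [//|c2] : #|cluster u| = 1 \/ #|cluster u| = 2 by move: cle c0 q4; clear; lia.
have qE : q = 4 by move: cle q4; rewrite c2; clear; lia.
have [sX Xq cX] := kX.
have clE := clique_cluster G kX uX uD.
have [a [aV aX eua Ea]] := clique_outer G kX uX uD.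
have /cards1P[w Ew] : #|cluster u :\ u| == 1 by move: c2; rewrite (cardsD1 u) cu add1n => -[->].
have : w \in cluster u :\ u by rewrite Ew set11.
rewrite in_setD1 => /andP[wu wC]; have [wV Ew'] := clusterP wC.
have wX : w \in X by move: wC; rewrite clE inE => /andP[].
have Z2 : #|X :\ u :\ w| == 2.
  have := cardsD1 u X; have := cardsD1 w (X :\ u).
  by rewrite uX !in_setD1 wu wX Xq qE; clear; lia.
have /cards2P[x [y [xy Zxy]]] := Z2.
have inZ z : (z \in X :\ u :\ w) = (z == x) || (z == y) by rewrite Zxy !inE.
have /and3P[xw xu xX] : [&& x != w, x != u & x \in X].
  by have := inZ x; rewrite eqxx !in_setD1.
have /and3P[yw yu yX] : [&& y != w, y != u & y \in X].
  by have := inZ y; rewrite eqxx orbT !in_setD1.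
have xV := subsetP sX _ xX; have yV := subsetP sX _ yX.
have XE z : z \in X -> [|| z == u, z == w, z == x | z == y].
  by move=> zX; have := inZ z; rewrite !in_setD1 zX andbT; case: (z == u); case: (z == w) => //= ->.
have nE t z : t \in [set u; w] -> z \in V -> e t z -> z \notin [set u; w] ->
    [|| z == a, z == x | z == y].
  move=> tuw zV etz zuw.
  have Et : cnbh e V t = cnbh e V u by move: tuw; rewrite in_set2 => /orP[]/eqP->.
  have : z \in cnbh e V t by rewrite inE zV etz orbT.
  rewrite Et Ea in_setU1; case: eqVneq => //= _ /XE; move: zuw; rewrite !inE.
  by case: (z == u); case: (z == w).
have ewa : e w a.
  have : a \in cnbh e V w by rewrite Ew' Ea setU11.
  by rewrite inE => /andP[_ /orP[/eqP E|//]]; rewrite E wX in aX.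
have euw : e u w by apply: cX => //; rewrite eq_sym.
have nax : ~~ e a x.
  apply/negP => eax; have := clique_out_le G kX aV aX; rewrite ecount1 qE.
  have : #|[set u; w] :|: [set x]| <= #|[set y in X | e a y]|.
    apply: subset_leq_card; rewrite !subUset !sub1set !inE uX wX xX eax.
    by rewrite !(esym a) eua ewa.
  rewrite cardsU cards2 cards1 eq_sym wu disjoint_setI0; last first.
    by rewrite disjoint_sym disjoints1 !inE negb_or xu xw.
  by rewrite cards0; clear; lia.
have au : a != u by apply: contraNneq aX => ->.
have aw : a != w by apply: contraNneq aX => ->.
have ax : a != x by apply: contraNneq aX => ->.
have ay : a != y by apply: contraNneq aX => ->.
pose e' := absorb e x a; pose V' := V :\ u :\ w :\ a.
have inV' z : z \in V' = [&& z != a, z != w, z != u & z \in V] by rewrite !in_setD1.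
have V'V : V' \subset V by apply/subsetP => z; rewrite inV' => /and4P[].
(* Give a the colour of x: apart from each other, u and w then see only the colours of x and y, and
   two of the four colours are left for them. *)
have nc : ~~ col q e' V'.
  apply: contra (cex_ncol G) => /colP[c pc].
  have pe y1 z1 : y1 \in V' -> z1 \in V' -> e y1 z1 -> c y1 != c z1.
    by move=> ? ? h; apply: pc => //; rewrite /e' /absorb h.
  have pa z : z \in V' -> e a z -> c x != c z.
    move=> zV' eaz; apply: pc => //; last by rewrite /e' /absorb eqxx eaz orbT.
    by rewrite inV' (eq_sym x) ax xw xu.
  pose Fr := ~: (c @: [set x; y]).
  have : 1 < #|Fr|.
    have := leq_imset_card c [set x; y]; have := cardsC (c @: [set x; y]).
    by rewrite card_ord -/Fr cards2 xy; move: qE; clear; lia.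
  case/card_gt1P => n [m [nF mF nm]].
  have Frxy n0 : n0 \in Fr -> (c x != n0) && (c y != n0).
    rewrite inE => n0F; apply/andP; split; apply: contraNneq n0F => <-;
      by apply: imset_f; rewrite !inE eqxx ?orbT.
  pose c1 z := if z == a then c x else c z.
  have c1N t n0 : t \in [set u; w] -> n0 \in Fr ->
      {in V :\ u :\ w, forall z, e t z -> c1 z != n0}.
    move=> tuw /Frxy/andP[nx ny] z; rewrite !in_setD1 => /and3P[zw zu zV] etz.
    have := nE t z tuw zV etz; rewrite !inE (negbTE zw) (negbTE zu) => /(_ isT).
    rewrite /c1; case: (eqVneq z a) => //= _; by case/orP => /eqP->.
  apply: (extend_col2 esym eirr (c := c1) _ nm); last first.
  - by apply: (c1N w); rewrite // !inE eqxx orbT.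
  - by apply: (c1N u); rewrite // !inE eqxx.
  move=> y1 z1; rewrite !in_setD1 => /and3P[y1w y1u y1V] /and3P[z1w z1u z1V] e1; rewrite /c1.
  case: (eqVneq y1 a) => [Ey|y1a]; case: (eqVneq z1 a) => [Ez|z1a].
  - by rewrite Ey Ez eirr in e1.
  - by apply: pa; rewrite ?inV' ?z1a ?z1w ?z1u // -Ey.
  - by rewrite eq_sym; apply: pa; rewrite ?inV' ?y1a ?y1w ?y1u // -Ez esym.
  by apply: pe; rewrite // inV' ?y1a ?z1a ?y1w ?y1u ?z1w ?z1u.
have lt : #|V'| < #|V|.
  by apply: proper_card; apply/properP; split=> //; exists u; rewrite // inV' eqxx !andbF.
have [|W [sW ncW rW]] := cex_min G (absorb_sym x a esym) (absorb_irr eirr nax) _ nc.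
  by left.
have WP z : z \in W -> [&& z != a, z != w, z != u & z \in V].
  by move/(subsetP sW); rewrite inV'.
have sWV := subset_trans sW V'V.
have W0 := ncol_neq0 (ltnW (ltnW q3)) ncW.
have xW : x \in W.
  apply: contraT => xW; have := cex_pot G sWV W0.
  by rewrite ltNge; move: rW; rewrite /rho absorb_out // => ->.
have W1 : 1 < #|W|.
  rewrite ltnNge; apply/negP => le1.
  have E : W = [set x] by apply/eqP; rewrite eq_sym eqEcard sub1set xW cards1.
  move: rW; rewrite E rho1; last exact: absorb_irr.
  by rewrite qE.
have aW : a \notin W by apply/negP => /WP; rewrite eqxx.
have wW : w \notin W by apply/negP => /WP; rewrite eqxx andbF.
have uW : u \notin W by apply/negP => /WP; rewrite eqxx !andbF.
have waW : w \notin a |: W by rewrite !inE negb_or eq_sym aw wW.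
have uwaW : u \notin w |: (a |: W) by rewrite !inE !negb_or (eq_sym u w) wu eq_sym au uW.
have HW := ecount_absorb esym eirr nax xW.
pose W3 := u |: (w |: (a |: W)).
have W3V : W3 \subset V by rewrite !subUset !sub1set uV wV aV.
have exX t z : t \in X -> z \in X -> t != z -> e t z by move=> tX zX; apply: cX.
have ew : 2 + (y \in W) <= ecount e [set w] (a |: W).
  have : [set a] :|: ([set x] :|: (if y \in W then [set y] else set0)) \subset [set z in a |: W | e w z].
    rewrite !subUset !sub1set !inE eqxx xW ewa orbT exX // 1?eq_sym //=.
    by case: ifP => yW; rewrite ?sub0set ?sub1set // !inE yW orbT exX // eq_sym.
  move/subset_leq_card; rewrite -ecount1; apply: leq_trans.
  rewrite cardsU1 cardsU1 !inE (negbTE ax) /=.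
  by case: ifP => yW; rewrite !inE ?cards1 ?cards0 ?xy ?(negbTE ay).
have eu : 3 + (y \in W) <= ecount e [set u] (w |: (a |: W)).
  have : [set w] :|: ([set a] :|: ([set x] :|: (if y \in W then [set y] else set0)))
      \subset [set z in w |: (a |: W) | e u z].
    rewrite !subUset !sub1set !inE eqxx xW eqxx eua euw !orbT (exX u x) // 1?eq_sym //=.
    by case: ifP => yW; rewrite ?sub0set ?sub1set // !inE yW !orbT exX // eq_sym.
  move/subset_leq_card; rewrite -ecount1; apply: leq_trans.
  rewrite 3!cardsU1 !inE (negbTE ax) (eq_sym w) (negbTE aw) (eq_sym w) (negbTE xw) /=.
  by case: ifP => yW; rewrite !inE ?cards1 ?cards0 ?xy ?(negbTE ay) // eq_sym (negbTE yw).
have rW3 : rho q e W3 = (rho q e W + 3 * rho_K1 q - (2 * q * ecount e [set a] W)%N%:Z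
    - (2 * q * ecount e [set w] (a |: W))%N%:Z
    - (2 * q * ecount e [set u] (w |: (a |: W)))%N%:Z)%R.
  by rewrite /W3 !rhoU1 //; clear; lia.
(* The edges lent by a to x are recovered once a itself joins W; u and w then bring at least five
   further edges, seven if y is in W. *)
have rW' : (rho q e W <= rho_max q + (2 * q * ecount e [set a] W)%N%:Z)%R.
  move: rW HW; rewrite /rho -/e' qE; clear; lia.
have : (rho q e W3 <= rho_max q + 3 * rho_K1 q - (2 * q * (5 + 2 * (y \in W)))%N%:Z)%R.
  move: rW3 rW' ew eu; rewrite qE; clear; lia.
(* For q = 4 the bound is 8 if y is in W, below rho_max = 10. Otherwise it is 24 = rho_Kq, for a set
   made proper by the absence of y. *)
have [yW|yW] := boolP (y \in W) => /= le.
  have W30 : W3 != set0 by apply/set0Pn; exists u; rewrite setU11.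
  by have := cex_pot G W3V W30; rewrite ltNge (le_trans le) // qE.
have pW3 : W3 \proper V.
  apply/properP; split=> //; exists y => //.
  by rewrite !inE (negbTE yW) (negbTE yu) (negbTE yw) eq_sym (negbTE ay).
have qW3 : q < #|W3| by rewrite /W3 !cardsU1 uwaW waW aW; move: W1 q4; clear; lia.
by have := cex_big G pW3 qW3; rewrite ltNge (le_trans le) // qE.
Qed.

End SmallCliques.

(** * Discharging *)

Section KernelBound.

Variables (q : nat) (T : finType) (e : rel T) (V : {set T}).
Hypothesis G : min_cex q e V.

Let q3 := cex_q G.
Let esym := cex_sym G.
Let eirr := cex_irr G.

Local Notation deg := (deg e V).
Local Notation lowV := (lowV q e V).

Definition crossing (A B : {set T}) : {set T * T} :=
  [set p | [&& p.1 \in A, p.2 \in B & e p.1 p.2]].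

Lemma card_crossing A B : #|crossing A B| = ecount e A B.
Proof.
rewrite -sum1_card big_mkcond /= /ecount.
rewrite (eq_bigr (fun p => if p.1 \in A then if p.2 \in B then (e p.1 p.2 : nat) else 0 else 0)).
  rewrite -(pair_bigA _ (fun x y => if x \in A then if y \in B then (e x y : nat) else 0 else 0)) /=.
  rewrite [RHS]big_mkcond /=; apply: eq_bigr => x _; case: ifP => _; last by rewrite big1.
  by rewrite [RHS]big_mkcond.
by move=> p _; rewrite inE; case: (p.1 \in A); case: (p.2 \in B); case: (e p.1 p.2).
Qed.

(* Demands of the orientation: one edge for each vertex of A, two for each
   vertex of B (one for each value of the boolean). *)
Let demands (A B : {set T}) : {set T * bool} :=
  [set p | if p.2 then p.1 \in A :|: B else p.1 \in B].

Let incident (A B : {set T}) (p : T * bool) : {set T * T} :=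
  [set d in crossing A B | (d.1 == p.1) || (d.2 == p.1)].

(** An edge assigned to a demand points towards the vertex demanding it. Within S, a vertex of A
    thus has out-degree below its degree and a vertex of B at least two below. A list keeps at least
    as many colours as the degree within S, one fewer on B, so lists exceed out-degrees and a
    colouring of the rest of G extends. *)
Lemma orientation_col (A B : {set T}) (f : T * bool -> T * T) :
  A \subset lowV -> {in A &, forall x y, ~~ e x y} -> B \subset V ->
  {in B, forall b, deg b = q.+1} -> [disjoint A & B] -> A :|: B != set0 ->
  {in demands A B, forall p, f p \in incident A B p} ->
  {in demands A B &, injective f} -> False.
Proof.
move=> AD Ai BV Bd dAB S0 fF fi; set S := A :|: B.
have nAB x : x \in A -> x \in B -> False.
  by move=> xA xB; have := disjoint_setI0 dAB; move/setP/(_ x); rewrite !inE xA xB.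
have SV : S \subset V.
  by rewrite subUset BV andbT; apply/subsetP => x /(subsetP AD)/lowV_V.
have [x0 x0S] := set0Pn _ S0.
have /colP[c pc] : col q e (V :\: S).
  apply: (cex_crit G); apply/properP; split; first exact: subsetDl.
  by exists x0; rewrite ?(subsetP SV) // inE x0S.
pose L x := ~: (c @: (nbhV e V x :\: S)).
pose dS x := #|nbhV e V x :&: S|.
have LE x : q + dS x <= #|L x| + deg x.
  have := cardsID S (nbhV e V x); rewrite -/(deg x) -/(dS x).
  have := leq_imset_card c (nbhV e V x :\: S).
  have := cardsC (c @: (nbhV e V x :\: S)); rewrite card_ord -/(L x).
  by clear; lia.
pose toB : rel T := fun a b => ((a, b) == f (b, true)) || ((a, b) == f (b, false)).
pose o := arc e toB A.
have oS x : [set y in S | o x y] = [set y in nbhV e V x :&: S | o x y].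
  apply/setP => y; rewrite !inE /o /arc; case: (boolP (y \in S)); rewrite inE; last first.
    by rewrite negb_or => /andP[/negbTE-> /negbTE->]; rewrite andbF.
  move=> yS; rewrite yS andbT; case: (e x y); rewrite ?andbF //=.
  by rewrite (subsetP SV) // inE.
have oA a : a \in A -> #|[set y in S | o a y]| < dS a.
  move=> aA; have aI : (a, true) \in demands A B by rewrite inE /= inE aA.
  have := fF _ aI; rewrite !inE /= -!andbA => /and4P[a1 b1 e1].
  case Ef: (f (a, true)) a1 b1 e1 => [a' b] /= a1 b1 e1.
  case/orP => /eqP E; last by case: (nAB a); rewrite // -E.
  rewrite E in Ef e1; have bS : b \in S by rewrite inE b1 orbT.
  rewrite oS; apply: proper_card; apply/properP; split.
    by apply/subsetP => y; rewrite inE => /andP[].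
  exists b; first by rewrite !inE e1 b1 orbT andbT (subsetP BV).
  rewrite inE /o /arc aA e1 /=; apply/negP => /andP[_ /orP[] /eqP Eb];
    rewrite -Ef in Eb; have := fi _ _ aI _ Eb; rewrite !inE /= b1 ?orbT => /(_ isT) [] Eab;
    by case: (nAB a); rewrite // Eab.
have oB b : b \in B -> (#|[set y in S | o b y]|).+1 < dS b.
  move=> bB; have It t : (b, t) \in demands A B by rewrite inE /=; case: t; rewrite ?inE bB ?orbT.
  have ft t : exists a, [/\ a \in A, e a b & f (b, t) = (a, b)].
    have := fF _ (It t); rewrite !inE /= -!andbA => /and4P[a1 b1 e1].
    case: (f (b, t)) a1 b1 e1 => a b' /= a1 b1 e1 /orP[] /eqP E.
      by case: (nAB b); rewrite // -E.
    by exists a; rewrite -E.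
  have [a1 [a1A e1 f1]] := ft true; have [a2 [a2A e2 f2]] := ft false.
  have a12 : a1 != a2.
    by apply/eqP => E; have := fi _ _ (It true) (It false); rewrite f1 f2 E => /(_ erefl).
  have bA : b \notin A by apply/negP => bA; apply: (nAB b).
  rewrite oS -/(dS b).
  have : [set y in nbhV e V b :&: S | o b y] \subset (nbhV e V b :&: S) :\ a1 :\ a2.
    apply/subsetP => y; rewrite inE => /andP[yN]; rewrite !in_setD1 yN andbT.
    rewrite /o /arc (negbTE bA) => /andP[_ H]; apply/andP; split; apply: contraTneq H => ->.
      by rewrite a2A negbK /toB f2 eqxx orbT.
    by rewrite a1A negbK /toB f1 eqxx.
  move/subset_leq_card => le.
  have in1 : a1 \in nbhV e V b :&: S.
    by rewrite !inE esym e1 a1A (lowV_V (subsetP AD _ a1A)).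
  have in2 : a2 \in (nbhV e V b :&: S) :\ a1.
    by rewrite in_setD1 eq_sym a12 !inE esym e2 a2A (lowV_V (subsetP AD _ a2A)).
  have := cardsD1 a1 (nbhV e V b :&: S); have := cardsD1 a2 ((nbhV e V b :&: S) :\ a1).
  rewrite in1 in2 /dS; move: le; clear; lia.
have C0 : 0 < #|'I_q| by rewrite card_ord; move: q3; clear; lia.
have [||c2 c2L pc2] := @kernel_list_col T 'I_q e o C0 S L.
- move=> S' sS'; have [K kK] := bipartite_kernel toB esym eirr Ai sS'.
  by exists K.
- move=> x; rewrite inE => /orP[] xS.
    apply: leq_trans (oA x xS) _; have := LE x.
    by rewrite (lowV_deg (subsetP AD _ xS)) addnC leq_add2r.
  have := LE x; rewrite (Bd x xS) addnS addnC -addSn leq_add2r => le.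
  by rewrite -ltnS; apply: leq_trans (oB x xS) le.
case/negP: (cex_ncol G); apply/colP.
exists (fun x => if x \in S then c2 x else c x) => x y xV yV exy.
have LP z w : z \in S -> w \in V -> w \notin S -> e z w -> c2 z != c w.
  move=> zS wV wS ezw; have := c2L z zS; rewrite inE; apply: contraNneq => ->.
  by apply: imset_f; rewrite in_setD wS inE wV.
case: ifP => xS; case: ifP => yS.
- exact: pc2.
- by apply: LP; rewrite ?yS.
- by rewrite eq_sym; apply: LP; rewrite ?xS // esym.
by apply: pc; rewrite ?in_setD ?xS ?yS.
Qed.

(* If Hall's condition holds for the demands, the resulting orientation makes a
   colouring of the rest of G extend; otherwise delete a violating set. *)
Lemma low_degS_bound (A B : {set T}) : A \subset lowV -> {in A &, forall x y, ~~ e x y} ->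
  B \subset V -> {in B, forall b, deg b = q.+1} -> [disjoint A & B] ->
  ecount e A B <= #|A| + 2 * #|B|.
Proof.
move: {2}(#|A| + #|B|).+1 (ltnSn (#|A| + #|B|)) => n.
elim: n A B => // n IH A B; rewrite ltnS => ABn AD Ai BV Bd dAB.
have [S0|S0] := eqVneq (A :|: B) set0.
  move/eqP: S0; rewrite setU_eq0 => /andP[/eqP-> _].
  by rewrite ecount_set0l.
have [x0 _] := set0Pn _ S0.
have [/existsP[J /andP[JD Jlt]]|/existsPn Hs] := boolP
  [exists J : {set T * bool}, (J \subset demands A B) && (#|nbh (incident A B) J| < #|J|)]; last first.
  have E0 : 0 < #|{: T * T}| by apply/card_gt0P; exists (x0, x0).
  have [J sJ|f fF fi] := @hall _ _ (incident A B) (demands A B) E0.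
    by have := Hs J; rewrite sJ /= -leqNgt.
  by case: (orientation_col AD Ai BV Bd dAB S0 fF fi).
pose SA := [set a in A | (a, true) \in J].
pose SB := [set b in B | ((b, true) \in J) || ((b, false) \in J)].
have sSA : SA \subset A by apply/subsetP => x; rewrite inE => /andP[].
have sSB : SB \subset B by apply/subsetP => x; rewrite inE => /andP[].
have Jle : #|J| <= #|SA| + 2 * #|SB|.
  have : J \subset (fun x => (x, true)) @: (SA :|: SB) :|: (fun x => (x, false)) @: SB.
    apply/subsetP => -[x t] xJ; have := subsetP JD _ xJ; rewrite !inE /=.
    case: t xJ => xJ H; apply/orP; [left|right]; apply: imset_f; rewrite !inE xJ ?orbT ?andbT //.
  move/subset_leq_card => le; apply: leq_trans le _.
  rewrite cardsU (leq_trans (leq_subr _ _)) // mul2n -addnn addnA.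
  apply: leq_add; last exact: leq_imset_card.
  apply: leq_trans (leq_imset_card _ _) _; rewrite cardsU; exact: leq_subr.
(* Deleting SA and SB destroys only edges incident to a demand in J, which are fewer than |J|. *)
have cov : crossing A B \subset crossing (A :\: SA) (B :\: SB) :|: nbh (incident A B) J.
  apply/subsetP => -[a b] abC; have := abC; rewrite inE /= => /and3P[aA bB eab].
  have [aS|aS] := boolP (a \in SA).
    rewrite inE; apply/orP; right; apply/bigcupP; exists (a, true); last by rewrite inE abC eqxx.
    by move: aS; rewrite inE => /andP[].
  have [bS|bS] := boolP (b \in SB).
    rewrite inE; apply/orP; right; move: bS; rewrite inE bB => /orP[] bJ; apply/bigcupP.
      by exists (b, true); rewrite // inE abC eqxx orbT.
    by exists (b, false); rewrite // inE abC eqxx orbT.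
  by rewrite inE; apply/orP; left; rewrite inE /= !in_setD aS bS aA bB.
have := subset_leq_card cov; have := cardsU (crossing (A :\: SA) (B :\: SB)) (nbh (incident A B) J).
rewrite !card_crossing.
have cA := cardsID SA A; rewrite (setIidPr sSA) in cA.
have cB := cardsID SB B; rewrite (setIidPr sSB) in cB.
have : ecount e (A :\: SA) (B :\: SB) <= #|A :\: SA| + 2 * #|B :\: SB|.
  apply: IH.
  - move: cA cB Jle Jlt ABn; clear; lia.
  - exact: subset_trans (subsetDl _ _) AD.
  - by move=> x y; rewrite !in_setD => /andP[_ xA] /andP[_ yA]; apply: Ai.
  - exact: subset_trans (subsetDl _ _) BV.
  - by move=> b; rewrite in_setD => /andP[_]; apply: Bd.
  by apply: disjointWl (subsetDl _ _) _; apply: disjointWr (subsetDl _ _) dAB.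
move: cA cB Jle Jlt; clear; lia.
Qed.

End KernelBound.

Lemma setIdD (T : finType) (A M : {set T}) (P : pred T) :
  [set x in A | P x] :\: M = [set x in A :\: M | P x].
Proof. by apply/setP => x; rewrite !inE andbA. Qed.

Section Charges.

Variables (q : nat) (T : finType) (e : rel T) (V : {set T}).
Hypothesis G : min_cex q e V.
Implicit Types (R W X Z S U : {set T}) (x y u v w a : T).

Let q3 := cex_q G.
Let esym := cex_sym G.
Let eirr := cex_irr G.

Local Notation deg := (deg e V).
Local Notation lowV := (lowV q e V).
Local Notation cluster := (cluster e V).
Local Notation qclique := (qclique q e V).

Definition degS : {set T} := [set x in V | deg x == q.+1].
Definition highV : {set T} := [set x in V | q.+1 < deg x].
(* Meant for vertices of degree above q only: the subtraction is truncated. *)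
Definition surplus v : nat := deg v * q - (q * q + q - 2).

(** Give each vertex the charge q deg - (q^2 + q - 2). The total is minus the potential of V, hence
    negative; the charge is -(q - 2) at degree q and 2 at degree q + 1. *)
Lemma total_surplus :
  \sum_(v in highV) surplus v + 2 * #|degS| < (q - 2) * #|lowV|.
Proof.
have tot : q * ecount e V V + 2 * #|V| < (q * q + q) * #|V|.
  have := cex_rhoV G; rewrite /rho /rho_max.
  have : 3 * q <= q * q by rewrite leq_mul2r q3 orbT.
  move: q3; clear; lia.
have sumV (A : {set T}) (f : T -> nat) : A \subset V ->
    \sum_(x in A) f x = \sum_(x in V) (x \in A) * f x.
  move=> sA; rewrite [LHS]big_mkcond /= [RHS]big_mkcond /=; apply: eq_bigr => x _.
  case: (boolP (x \in A)) => [/(subsetP sA) ->|_]; first by rewrite mul1n.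
  by rewrite mul0n if_same.
have lV : lowV \subset V by apply/subsetP => x; rewrite inE => /andP[].
have bV : degS \subset V by apply/subsetP => x; rewrite inE => /andP[].
have hV : highV \subset V by apply/subsetP => x; rewrite inE => /andP[].
have E : q * ecount e V V + 2 * #|V| + (q - 2) * #|lowV| =
    (q * q + q) * #|V| + (\sum_(v in highV) surplus v + 2 * #|degS|).
  rewrite -!sum1_card (sumV _ _ lV) (sumV _ _ bV) (sumV _ _ hV) ecount_card.
  rewrite !big_distrr /= -!big_split /=; apply: eq_bigr => x xV.
  rewrite /surplus !inE xV -/(nbhV e V x) -/(deg x) /=.
  move: (min_deg G xV); move: (deg x) => d qd.
  have [E|[E|lt]] : d = q \/ d = q.+1 \/ q.+1 < d by move: qd; clear; lia.
  - have -> : (q.+1 < d) = false by move: E; clear; lia.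
    have -> : (d == q.+1) = false by move: E; clear; lia.
    by rewrite E eqxx; move: q3; clear; nia.
  - have -> : (q.+1 < d) = false by move: E; clear; lia.
    have -> : (d == q) = false by move: E; clear; lia.
    by rewrite E eqxx; move: q3; clear; nia.
  have -> : (d == q.+1) = false by move: lt; clear; lia.
  have -> : (d == q) = false by move: lt; clear; lia.
  have : q.+2 * q <= d * q by rewrite leq_mul2r lt orbT.
  by rewrite lt; move: q3; clear; nia.
by move: tot E; clear; lia.
Qed.

(** Since q^2 + q - 2 = (q + 2)(q - 1), with equality at degree q + 2. A vertex of [highV] can thus
    give 1 to every neighbour. *)
Lemma surplus_deg v : v \in highV -> deg v <= surplus v.
Proof.
rewrite inE /surplus => /andP[_ lt].
have : q.+2 * q.-1 <= deg v * q.-1 by rewrite leq_mul2r lt orbT.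
move: q3 lt; move: (deg v) => d; case: q => [//|p] /=; clear; nia.
Qed.

Lemma low_split u : u \in lowV ->
  #|[set v in highV | e u v]| + #|[set v in degS | e u v]| + #|[set v in lowV | e u v]| = q.
Proof.
move=> uD; rewrite -[RHS](lowV_deg uD) /deg.
rewrite -(cardsID lowV (nbhV e V u)) -(cardsID degS (nbhV e V u :\: lowV)).
have -> : nbhV e V u :&: lowV = [set v in lowV | e u v].
  by apply/setP => v; rewrite !inE; case: (v \in V) => //=; rewrite andbC.
have -> : (nbhV e V u :\: lowV) :&: degS = [set v in degS | e u v].
  apply/setP => v; rewrite !inE; case: (v \in V) => //=; rewrite ?andbF //.
  case: (eqVneq (deg v) q.+1) => [->|]; last by rewrite !andbF.
  by rewrite (gtn_eqF (ltnSn q)) /= andbT.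
have -> : (nbhV e V u :\: lowV) :\: degS = [set v in highV | e u v].
  apply/setP => v; rewrite !inE; case: (boolP (v \in V)) => [vV|] //=; rewrite ?andbF //.
  have := min_deg G vV; rewrite leq_eqVlt => /orP[/eqP <-|].
    by rewrite eqxx andbF ltnNge leqnSn.
  rewrite leq_eqVlt => /orP[/eqP <-|lt]; first by rewrite eqxx ltnn.
  by rewrite lt (gtn_eqF lt) (gtn_eqF (ltn_trans (ltnSn q) lt)).
by clear; lia.
Qed.

Definition singles : {set T} := [set u in lowV | #|cluster u| == 1].

Lemma singlesP u : u \in singles -> u \in lowV /\ #|cluster u| = 1.
Proof. by rewrite inE => /andP[uD /eqP]. Qed.

Lemma single_cluster u : u \in singles -> cluster u = [set u].
Proof.
case/singlesP => uD /eqP/cards1P[z Ez]; have := mem_cluster e (lowV_V uD).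
by rewrite Ez inE => /eqP->.
Qed.

(** A cluster is a clique, so with q or more vertices it would contain a q-clique through u. *)
Lemma big_cluster_size u : u \in lowV -> (forall X, qclique X -> u \notin X) ->
  #|cluster u| < q.
Proof.
move=> uD noX; have uV := lowV_V uD; rewrite ltnNge; apply/negP => le.
have cc := cluster_clique (e := e) uV.
have cV : cluster u \subset V by apply/subsetP => x; rewrite inE => /andP[].
have uC : u \in cluster u := mem_cluster e uV.
have sub : cluster u \subset cnbh e V u.
  apply/subsetP => x xC; rewrite inE (subsetP cV) //=; case: eqVneq => //= xu.
  by apply: cc; rewrite // eq_sym.
have := subset_leq_card sub; rewrite (card_cnbh G) // (lowV_deg uD) leq_eqVlt => /orP[/eqP E|lt].
  have /card_gt0P[z] : 0 < #|cluster u :\ u|.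
    by have := cardsD1 u (cluster u); rewrite uC E; move: q3; clear; lia.
  rewrite in_setD1 => /andP[zu zC].
  have kZ : qclique (cluster u :\ z).
    split; first exact: subset_trans (subsetDl _ _) cV.
      by have := cardsD1 z (cluster u); rewrite zC E; clear; lia.
    exact: sub_clique (subsetDl _ _) cc.
  by have := noX _ kZ; rewrite in_setD1 eq_sym zu uC.
have kC : qclique (cluster u) by split=> //; apply/eqP; rewrite eqn_leq le andbT -ltnS.
by have := noX _ kC; rewrite uC.
Qed.

Lemma card_cluster_out u : u \in lowV -> #|nbhV e V u :\: cluster u| + #|cluster u| = q.+1.
Proof.
move=> uD; have uV := lowV_V uD.
have uC : u \in cluster u := mem_cluster e uV.
have -> : nbhV e V u :\: cluster u = cnbh e V u :\: cluster u.
  apply/setP => x; rewrite !in_setD cnbhE // in_setU1; case: eqVneq => //= ->.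
  by rewrite uC.
rewrite -(lowV_deg uD) -(card_cnbh G) // -(cardsID (cluster u) (cnbh e V u)) addnC.
congr (_ + _); apply: eq_card => x; rewrite in_setI.
case: (boolP (x \in cluster u)) => xC; rewrite ?andbF // andbT.
have [xV E] := clusterP xC.
by have : x \in cnbh e V x; [rewrite inE xV eqxx|rewrite E].
Qed.

End Charges.

(** * Discharging for q at most 4 *)

Section SmallCase.

Variables (q : nat) (T : finType) (e : rel T) (V : {set T}).
Hypothesis G : min_cex q e V.
Hypothesis q4 : q <= 4.
Implicit Types (R W X Z S U : {set T}) (x y u v w a b p : T).

Let q3 := cex_q G.
Let esym := cex_sym G.
Let eirr := cex_irr G.

Local Notation deg := (deg e V).
Local Notation lowV := (lowV q e V).
Local Notation cluster := (cluster e V).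
Local Notation qclique := (qclique q e V).
Local Notation degS := (degS q e V).
Local Notation highV := (highV q e V).
Local Notation singles := (singles q e V).

Lemma clique_single X u : qclique X -> u \in X -> u \in lowV -> u \in singles.
Proof. by move=> kX uX uD; rewrite inE uD (clique_low_single G q4 kX). Qed.

Lemma clique_low_eq X u v : qclique X -> u \in X -> u \in lowV -> v \in X -> v \in lowV -> v = u.
Proof.
move=> kX uX uD vX vD; have : v \in cluster u by rewrite (clique_cluster G kX uX uD) inE vX.
by rewrite (single_cluster (clique_single kX uX uD)) => /set1P.
Qed.

(** [single_low_nbr] puts y into a q-clique, which makes y a single as well; the same lemma then
    applies from y to u. *)
Lemma single_nbr u y : u \in singles -> y \in lowV -> e u y ->
  y \in singles /\ exists X, [/\ qclique X, u \in X & y \notin X].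
Proof.
move=> uL yD euy; have [uD cu] := singlesP uL.
have [Z [kZ yZ uZ]] := single_low_nbr G uD cu yD euy.
have yL := clique_single kZ yZ yD; split=> //; have [_ cy] := singlesP yL.
by apply: (single_low_nbr G yD cy uD); rewrite esym.
Qed.

Lemma single_nbr_uniq u y z : u \in singles -> y \in lowV -> z \in lowV ->
  e u y -> e u z -> y = z.
Proof.
move=> uL yD zD euy euz; have [uD cu] := singlesP uL.
have [_ [X [kX uX yX]]] := single_nbr uL yD euy.
have [a [aV aX eua Ea]] := clique_outer G kX uX uD.
have H v : v \in lowV -> e u v -> v = a.
  move=> vD euv; have : v \in a |: X by rewrite -Ea inE (lowV_V vD) euv orbT.
  rewrite in_setU1 => /orP[/eqP//|vX]; move: euv.
  by rewrite (clique_low_eq kX uX uD vX vD) eirr.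
by rewrite (H y) // (H z).
Qed.

(** By [single_nbr] and [single_nbr_uniq] the edges among these vertices form a perfect matching of
    them. *)
Definition matched : {set T} := [set u in singles | [exists y in lowV, e u y]].

Lemma matched_single u : u \in matched -> u \in singles.
Proof. by rewrite inE => /andP[]. Qed.

Lemma matched_degS u b : u \in matched -> b \in degS -> e u b ->
  exists X, [/\ qclique X, u \in X & b \in X].
Proof.
rewrite inE => /andP[uL /exists_inP[y yD euy]] bB eub.
have [uD cu] := singlesP uL; have [yL [X [kX uX yX]]] := single_nbr uL yD euy.
exists X; split=> //; have [a [aV aX eua Ea]] := clique_outer G kX uX uD.
have inX v : v \in V -> e u v -> (v == a) || (v \in X).
  by move=> vV euv; rewrite -in_setU1 -Ea inE vV euv orbT.
have := inX y (lowV_V yD) euy; rewrite (negbTE yX) orbF => /eqP Eya.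
have : (b == a) || (b \in X) by apply: inX => //; move: bB; rewrite inE => /andP[].
case/orP => // /eqP Eba; move: bB; rewrite Eba -Eya inE => /andP[_].
by rewrite (lowV_deg yD) (ltn_eqF (ltnSn q)).
Qed.

(** In the q-clique X of u and b the only vertex of degree q is u, and b has two neighbours outside
    X. If both are singles and p is another matched neighbour of b, the q-clique of p and b must be
    X with u exchanged for p, giving p too many neighbours in X. *)
Lemma matched_degS_nbrs u b : u \in matched -> b \in degS -> e u b ->
  #|[set x in singles | e b x]| <= 3 /\
  (#|[set x in singles | e b x]| = 3 -> {in matched, forall p, e p b -> p = u}).
Proof.
move=> uM bB eub; have uL := matched_single uM; have [uD cu] := singlesP uL.
have [X [kX uX bX]] := matched_degS uM bB eub; have [sX Xq cX] := kX.
have db : deg b = q.+1 by move: bB; rewrite inE => /andP[_ /eqP].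
have bV : b \in V by move: bB; rewrite inE => /andP[].
set Lb := [set x in singles | e b x].
have LbD x : x \in Lb -> x \in lowV by rewrite inE => /andP[/singlesP[]].
have in1 : #|Lb :&: X| <= 1.
  rewrite -(cards1 u); apply: subset_leq_card; apply/subsetP => x.
  by rewrite in_setI in_set1 => /andP[/LbD xD xX]; rewrite (clique_low_eq kX uX uD xX xD).
have out2 : #|nbhV e V b :\: X| = 2.
  have := card_clique_out G kX bX; rewrite db; clear; lia.
have sub : Lb :\: X \subset nbhV e V b :\: X.
  apply: setSD; apply/subsetP => x xL; rewrite inE (lowV_V (LbD x xL)).
  by move: xL; rewrite inE => /andP[].
have := cardsID X Lb; have le2 := subset_leq_card sub; rewrite out2 in le2 => cL.
split; first by move: cL in1 le2; clear; lia.
move=> L3 p pM epb; apply: contraTeq isT => pu /=.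
have [pL [pD cp]] := (matched_single pM, singlesP (matched_single pM)).
have outE : Lb :\: X = nbhV e V b :\: X.
  by apply/eqP; rewrite eqEcard sub out2; move: cL in1 L3; clear; lia.
have pX : p \notin X by apply: contra_neqN pu => pX; apply: clique_low_eq kX uX uD pX pD.
have [X' [kX' pX' bX']] := matched_degS pM bB epb; have [sX' X'q cX'] := kX'.
have uX' : u \notin X'.
  by apply: contra_neqN pu => uX'; rewrite (clique_low_eq kX' pX' pD uX' uD).
have sub' : X' \subset p |: (X :\ u).
  apply/subsetP => z zX'; rewrite in_setU1 in_setD1.
  have zu : z != u by apply: contraTneq zX' => ->.
  rewrite zu /=; case: (boolP (z \in X)) => zX; rewrite ?orbT // orbF.
  have zb : b != z by apply: contraTneq bX => ->.
  have : z \in Lb :\: X by rewrite outE !inE zX (subsetP sX') // cX'.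
  rewrite in_setD zX /= => /LbD zD.
  by rewrite (clique_low_eq kX' pX' pD zX' zD).
have E : X' = p |: (X :\ u).
  apply/eqP; rewrite eqEcard sub' X'q cardsU1.
  have := cardsD1 u X; rewrite uX Xq in_setD1 (negbTE pX) andbF; clear; lia.
have := clique_out_le G kX (lowV_V pD) pX; rewrite ecount1.
have : #|X :\ u| <= #|[set y in X | e p y]|.
  apply: subset_leq_card; apply/subsetP => z zX; rewrite inE.
  have := zX; rewrite in_setD1 => /andP[_ zX1]; rewrite zX1 /=.
  apply: cX' => //; first by rewrite E in_setU1 zX orbT.
  by apply: contraNneq pX => ->.
have := cardsD1 u X; rewrite uX Xq; move: q3; clear; lia.
Qed.

Let unmatched := singles :\: matched.
Let heavy : {set T} :=
  [set b in degS | (2 < #|[set x in singles | e b x]|) && [exists u in matched, e u b]].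
Let near U : {set T} := [set b in degS | [exists u in U, e u b]].

(** A heavy vertex has three neighbours in [singles], only one of them matched; the other two are
    unmatched, of degree q. *)
Lemma heavy_le : 2 * #|heavy| <= q * #|unmatched|.
Proof.
apply: (@leq_trans (ecount e heavy unmatched)).
  rewrite ecount_card mulnC -sum_nat_const; apply: leq_sum => b.
  rewrite inE => /and3P[bB b3 /exists_inP[u uM eub]].
  have [le3 uq] := matched_degS_nbrs uM bB eub.
  have := cardsID matched [set x in singles | e b x].
  have -> : [set x in singles | e b x] :\: matched = [set y in unmatched | e b y].
    exact: setIdD.
  have : #|[set x in singles | e b x] :&: matched| <= 1.
    rewrite -(cards1 u); apply: subset_leq_card; apply/subsetP => p.
    rewrite in_setI in_set1 => /andP[]; rewrite inE => /andP[_ ebp] pM; apply/eqP.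
    by apply: uq; rewrite // ?(esym p) //; apply/eqP; rewrite eqn_leq le3.
  by move: b3; clear; lia.
rewrite (ecountC esym) mulnC ecount_card -sum_nat_const; apply: leq_sum => x.
rewrite in_setD => /andP[_ /singlesP[xD _]]; rewrite -[X in _ <= X](lowV_deg xD).
apply: subset_leq_card; apply/subsetP => b; rewrite !inE.
by case/andP => /andP[/andP[-> _] _] ->.
Qed.

(** The kernel bound applies to the unmatched singles with U, against the vertices of [degS] that
    have no neighbour in U'. The vertices near U' have at most two single neighbours, or three if
    heavy. *)
Lemma singles_degS_half U U' : U :|: U' = matched -> {in U &, forall x y, ~~ e x y} ->
  ecount e singles degS <= #|unmatched| + #|U| + 2 * #|degS| + #|heavy :&: near U'|.
Proof.
move=> UU' Ui; set A := unmatched :|: U.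
have UM : U \subset matched by rewrite -UU' subsetUl.
have sML : matched \subset singles by apply/subsetP => x /matched_single.
have AL : A \subset singles.
  by rewrite subUset subsetDl (subset_trans UM sML).
have LD : singles \subset lowV by apply/subsetP => x /singlesP[].
have nun x y : x \in unmatched -> y \in lowV -> ~~ e x y.
  rewrite in_setD => /andP[xM xL] yD; apply: contra xM => exy; rewrite inE xL /=.
  by apply/exists_inP; exists y.
have Ai : {in A &, forall x y, ~~ e x y}.
  move=> x y xA yA; have xD := subsetP LD _ (subsetP AL _ xA).
  have yD := subsetP LD _ (subsetP AL _ yA).
  move: xA yA; rewrite !in_setU => /orP[xS|xU]; first by move=> _; apply: nun.
  by case/orP => [yS|yU]; [rewrite esym nun|apply: Ui].
have nS : near U' \subset degS by apply/subsetP => b; rewrite inE => /andP[].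
set B' := degS :\: near U'.
have dB : {in B', forall b, deg b = q.+1} by move=> b; rewrite !inE => /andP[_ /andP[_ /eqP]].
have BV : B' \subset V by apply/subsetP => b; rewrite !inE => /andP[_ /andP[]].
have dAB : [disjoint A & B'].
  rewrite -setI_eq0; apply/eqP/setP => x; rewrite in_setI in_set0; apply/negP => /andP[xA xB].
  have := dB x xB; rewrite (lowV_deg (subsetP LD _ (subsetP AL _ xA))).
  by move/eqP; rewrite (ltn_eqF (ltnSn q)).
have K := low_degS_bound G (subset_trans AL LD) Ai BV dB dAB.
have -> : ecount e singles degS = ecount e singles B' + ecount e singles (near U').
  rewrite -ecountUr; last by rewrite disjoints_subset /B' setDE subsetIr.
  by rewrite -{1}(setID degS (near U')) (setIidPr nS) setUC.
have E1 : ecount e singles B' <= ecount e A B'.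
  rewrite (ecountC esym) (ecountC esym A) !ecount_card; apply: leq_sum => b bB.
  apply: subset_leq_card; apply/subsetP => x; rewrite inE => /andP[xL ebx].
  rewrite inE ebx andbT in_setU; case: (boolP (x \in matched)) => xM; last by rewrite /unmatched in_setD xM xL.
  have : x \in U :|: U' by rewrite UU'.
  rewrite inE => /orP[->|xU']; first by rewrite orbT.
  move: bB; rewrite !in_setD => /andP[/negP nb bB]; case: nb; rewrite inE bB /=.
  by apply/exists_inP; exists x; rewrite // esym.
have E2 : ecount e singles (near U') <= 2 * #|near U'| + #|heavy :&: near U'|.
  rewrite (ecountC esym) ecount_card.
  apply: (@leq_trans (\sum_(b in near U') (2 + (b \in heavy)))).
    apply: leq_sum => b; rewrite inE => /andP[bB /exists_inP[u uU' eub]].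
    have uM : u \in matched by rewrite -UU' inE uU' orbT.
    have [le3 _] := matched_degS_nbrs uM bB eub.
    case: (leqP #|[set x in singles | e b x]| 2) => [le|lt]; first by apply: leq_trans le _; apply: leq_addr.
    have -> : b \in heavy by rewrite inE bB lt; apply/exists_inP; exists u.
    exact: le3.
  rewrite big_split /= sum_nat_const mulnC leq_add2l -sum1_card big_mkcond /= [X in _ <= X]big_mkcond /=.
  by apply: leq_sum => b _; rewrite in_setI; case: (b \in heavy); case: (b \in near U').
have cB := cardsID (near U') degS; rewrite (setIidPr nS) -/B' in cB.
have cA : #|A| <= #|unmatched| + #|U| by rewrite cardsU leq_subr.
move: K E1 E2 cB cA; clear; lia.
Qed.

(** The enumeration order of T splits the matching into independent halves U1 and U2, and the two
    half bounds are added. A heavy vertex, having one matched neighbour, is near only one half, so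
    the excess is at most |heavy|, hence at most 2 |unmatched| as q <= 4. *)
Lemma singles_degS_bound : ecount e singles degS + #|matched| <= 2 * #|singles| + 2 * #|degS|.
Proof.
pose rk (x : T) : nat := enum_rank x.
pose U1 := [set u in matched | [forall y in matched, e u y ==> (rk u < rk y)]].
pose U2 := matched :\: U1.
have U1M : U1 \subset matched by apply/subsetP => x; rewrite inE => /andP[].
have UE : U1 :|: U2 = matched by rewrite -[RHS](setID matched U1) (setIidPr U1M).
have U1i : {in U1 &, forall x y, ~~ e x y}.
  move=> x y; rewrite !inE -/matched => /andP[xM /forall_inP Hx] /andP[yM /forall_inP Hy].
  apply/negP => exy; have := Hx y; have := Hy x; rewrite !inE in xM yM *.
  rewrite xM yM exy esym exy => /(_ isT) /= l1 /(_ isT) /= l2.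
  by have := ltn_trans l1 l2; rewrite ltnn.
have ML x : x \in matched -> x \in lowV by move/matched_single/singlesP => [].
have U2P x : x \in U2 -> exists y, [/\ y \in matched, e x y & rk y < rk x].
  rewrite in_setD inE => /andP[]; case: (boolP (x \in matched)) => //= xM.
  rewrite negb_forall_in => /exists_inP[y yM]; rewrite negb_imply -leqNgt => /andP[exy le] _.
  exists y; split=> //; rewrite ltn_neqAle le andbT; apply: contraTneq exy.
  by move/val_inj/enum_rank_inj=> ->; rewrite eirr.
have U2i : {in U2 &, forall x y, ~~ e x y}.
  move=> x y xU yU; apply/negP => exy.
  have [x' [x'M exx' lx]] := U2P x xU; have [y' [y'M eyy' ly]] := U2P y yU.
  have xM : x \in matched by move: xU; rewrite in_setD => /andP[].
  have yM : y \in matched by move: yU; rewrite in_setD => /andP[].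
  have Ex : x' = y by apply: (single_nbr_uniq (matched_single xM)) => //; apply: ML.
  have Ey : y' = x.
    by apply: (single_nbr_uniq (matched_single yM)); rewrite ?ML // esym.
  by rewrite Ex in lx; rewrite Ey in ly; have := ltn_trans lx ly; rewrite ltnn.
have dis : #|heavy :&: near U1| + #|heavy :&: near U2| <= #|heavy|.
  rewrite -(cardsID (near U1) heavy) leq_add2l; apply: subset_leq_card.
  apply/subsetP => b; rewrite in_setI in_setD => /andP[bH bN2]; rewrite bH andbT.
  apply/negP => bN1; move: bN1; rewrite inE => /andP[bB /exists_inP[u1 u1U e1]].
  move: bN2; rewrite inE => /andP[_ /exists_inP[u2 u2U e2]].
  have u1M := subsetP U1M _ u1U.
  have u2M : u2 \in matched by move: u2U; rewrite in_setD => /andP[].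
  have [le3 uq] := matched_degS_nbrs u1M bB e1.
  have E : u2 = u1.
    apply: uq => //; apply/eqP; rewrite eqn_leq le3.
    by move: bH; rewrite inE => /and3P[].
  by move: u2U; rewrite in_setD E u1U.
have H1 := singles_degS_half UE U1i.
have H2 : ecount e singles degS <= #|unmatched| + #|U2| + 2 * #|degS| + #|heavy :&: near U1|.
  by apply: singles_degS_half U2i; rewrite setUC.
have cU1 := subset_leq_card U1M.
have cU2 : #|U2| <= #|matched| by apply: subset_leq_card; apply: subsetDl.
have cL : #|unmatched| + #|matched| = #|singles|.
  have sML : matched \subset singles by apply/subsetP => x /matched_single.
  by have := cardsID matched singles; rewrite (setIidPr sML) addnC.
have hv := heavy_le.
have : q * #|unmatched| <= 4 * #|unmatched| by rewrite leq_mul2r q4 orbT.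
move: H1 H2 cU1 cU2 cL hv dis; clear; lia.
Qed.

Lemma small_case : False.
Proof.
have LD : singles \subset lowV by apply/subsetP => x /singlesP[].
have tot := total_surplus G.
have sH : ecount e lowV highV <= \sum_(v in highV) surplus q e V v.
  rewrite (ecountC esym) ecount_card; apply: leq_sum => v vH.
  apply: leq_trans (surplus_deg G vH); apply: subset_leq_card; apply/subsetP => x.
  by rewrite !inE => /andP[/andP[-> _] ->].
have lowE : lowV = singles :|: (lowV :\: singles).
  by rewrite -{1}(setID lowV singles) (setIidPr LD).
have dLB : [disjoint singles & lowV :\: singles].
  by rewrite disjoints_subset setCD subsetUr.
have big : (q - 2) * #|lowV :\: singles| <= ecount e (lowV :\: singles) highV.
  rewrite ecount_card mulnC -sum_nat_const; apply: leq_sum => u.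
  rewrite in_setD => /andP[nu uD]; have uV := lowV_V uD.
  have noX X : qclique X -> u \notin X.
    by move=> kX; apply: contra nu => uX; apply: clique_single kX uX uD.
  have c1 : 1 < #|cluster u|.
    have : 0 < #|cluster u| by apply/card_gt0P; exists u; apply: mem_cluster.
    by move: nu; rewrite inE uD /=; case: #|_| => [|[|]].
  have cq := big_cluster_size G uD noX; have cO := card_cluster_out G uD.
  (* At least two neighbours lie outside the cluster, and q - 2 <= 2; each has degree at least q +
     2. *)
  apply: (@leq_trans #|nbhV e V u :\: cluster u|).
    by move: cq cO q3 q4; clear; lia.
  apply: subset_leq_card; apply/subsetP => v; rewrite in_setD => /andP[vC vN].
  have /andP[vV euv] : (v \in V) && e u v by move: vN; rewrite inE.
  rewrite !inE vV euv andbT /=.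
  have := cluster_nbr_deg G uD c1 vV euv vC (or_introl noX); move: c1; clear; lia.
have sing : q * #|singles| <= ecount e singles highV + ecount e singles degS + #|matched|.
  rewrite !ecount_card -big_split /= mulnC -sum_nat_const.
  have -> : #|matched| = \sum_(u in singles) (u \in matched).
    rewrite -sum1_card [LHS]big_mkcond [RHS]big_mkcond /=; apply: eq_bigr => x _.
    by rewrite inE; case: (x \in singles) => //=; case: ifP.
  rewrite -big_split /=; apply: leq_sum => u uL; have [uD _] := singlesP uL.
  rewrite -{1}(low_split G uD) leq_add2l.
  case: (boolP (u \in matched)) => uM.
    apply/card_le1_eqP => x y; rewrite inE => /andP[xD exu]; rewrite inE => /andP[yD eyu].
    exact: (single_nbr_uniq uL).
  rewrite leqn0 cards_eq0; apply/eqP/setP => y; rewrite in_set0; apply/negP => yN.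
  case/negP: uM; rewrite inE uL; apply/exists_inP; exists y; by move: yN; rewrite inE => /andP[].
have bnd := singles_degS_bound.
have cD : #|lowV| = #|singles| + #|lowV :\: singles|.
  by have := cardsID singles lowV; rewrite (setIidPr LD).
have eD : ecount e lowV highV = ecount e singles highV + ecount e (lowV :\: singles) highV.
  by rewrite {1}lowE ecountUl.
have : (q - 2) * #|lowV| = (q - 2) * #|singles| + (q - 2) * #|lowV :\: singles|.
  by rewrite cD mulnDr.
have : (q - 2) * #|singles| + 2 * #|singles| = q * #|singles|.
  by rewrite -mulnDl subnK // ltnW.
move: tot sH big sing bnd eD; clear; lia.
Qed.

End SmallCase.

(** * Discharging for q at least 5 *)

Section LargeCase.

Variables (q : nat) (T : finType) (e : rel T) (V : {set T}).
Hypothesis G : min_cex q e V.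
Hypothesis q5 : 5 <= q.
Implicit Types (R W X Z S U P : {set T}) (x y u v w a b p : T).

Let q3 := cex_q G.
Let esym := cex_sym G.
Let eirr := cex_irr G.

Local Notation deg := (deg e V).
Local Notation lowV := (lowV q e V).
Local Notation cluster := (cluster e V).
Local Notation qclique := (qclique q e V).
Local Notation degS := (degS q e V).
Local Notation highV := (highV q e V).
Local Notation surplus := (surplus q e V).

Definition low_nbrs v : nat := #|[set y in lowV | e v y]|.

(** The surplus is divided equally among the neighbours of degree q; without any, the quotient by
    zero is 0. *)
Definition share v : rat := ((surplus v)%:R / (low_nbrs v)%:R)%R.
Definition received y : rat := (\sum_(v in [set v in highV | e y v]) share v)%R.

Lemma low_nbrs_deg v : low_nbrs v <= deg v.
Proof.
by apply: subset_leq_card; apply/subsetP => x; rewrite !inE => /andP[/andP[-> _] ->].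
Qed.

(** Every vertex of P sends y at least num/den; all comparisons are cross-multiplied into the
    naturals. *)
Lemma received_ge y P (num den K : nat) : y \in lowV -> 0 < den ->
  {in P, forall v, [/\ v \in highV, e y v & num * low_nbrs v <= den * surplus v]} ->
  K * den <= #|P| * num -> (K%:R <= received y)%R.
Proof.
move=> yD den0 HP HK.
have share0 v : (0 <= share v)%R by apply: divr_ge0; rewrite ler0n.
apply: (@le_trans _ _ (\sum_(v in P) share v)%R); last first.
  rewrite /received [leRHS](big_setID P) /=.
  have -> : [set v in highV | e y v] :&: P = P.
    by apply/setIidPr/subsetP => v /HP[vH eyv _]; rewrite inE vH.
  by rewrite lerDl; apply: sumr_ge0.
apply: (@le_trans _ _ (\sum_(v in P) num%:R / den%:R)%R); last first.
  apply: ler_sum => v vP; have [vH eyv le] := HP v vP.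
  have d0 : 0 < low_nbrs v by apply/card_gt0P; exists y; rewrite inE yD esym.
  rewrite /share ler_pdivrMr ?ltr0n // mulrAC ler_pdivlMr ?ltr0n //.
  by rewrite -!natrM ler_nat (mulnC (surplus v)).
rewrite sumr_const -[leRHS]mulr_natr mulrAC ler_pdivlMr ?ltr0n //.
by rewrite -!natrM ler_nat (mulnC num).
Qed.

Lemma received_sum (lb : T -> nat) : {in lowV, forall y, ((lb y)%:R <= received y)%R} ->
  \sum_(y in lowV) lb y <= \sum_(v in highV) surplus v.
Proof.
move=> H; rewrite -(ler_nat rat) natr_sum [leRHS]natr_sum.
apply: le_trans (ler_sum _ H) _; rewrite /received.
rewrite (exchange_big_dep (mem highV)) /=; last first.
  by move=> y v _; rewrite inE => /andP[].
apply: ler_sum => v vH.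
rewrite (eq_bigl [in [set y in lowV | e v y]]); last first.
  by move=> y /=; rewrite [v \in _]inE vH /= [in RHS]inE esym.
rewrite sumr_const -/(low_nbrs v) /share -[leLHS]mulr_natr.
case: (posnP (low_nbrs v)) => [->|d0]; first by rewrite mulr0 ler0n.
by rewrite divfK // pnatr_eq0 -lt0n.
Qed.

Lemma received_count y : y \in lowV -> (#|[set v in highV | e y v]|%:R <= received y)%R.
Proof.
move=> yD; apply: (@received_ge y [set v in highV | e y v] 1 1) => // v.
rewrite inE => /andP[vH eyv]; split=> //; rewrite !mul1n.
exact: leq_trans (low_nbrs_deg v) (surplus_deg G vH).
Qed.

(** Inside X only the cluster of u has degree q, and v has deg v - q + 1 neighbours outside X. *)
Lemma clique_low_nbrs X u v : qclique X -> u \in X -> u \in lowV -> v \in X ->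
  low_nbrs v + q <= #|cluster u| + (deg v).+1.
Proof.
move=> kX uX uD vX; have [sX Xq cX] := kX.
have := cardsID X [set y in lowV | e v y]; rewrite -/(low_nbrs v).
have : #|[set y in lowV | e v y] :&: X| <= #|cluster u|.
  apply: subset_leq_card; apply/subsetP => y; rewrite (clique_cluster G kX uX uD).
  by rewrite !in_setI => /andP[]; rewrite inE => /andP[-> _] ->.
have : #|[set y in lowV | e v y] :\: X| <= #|nbhV e V v :\: X|.
  apply: subset_leq_card; apply: setSD; apply/subsetP => y.
  by rewrite inE => /andP[yD evy]; rewrite inE (lowV_V yD).
by have := card_clique_out G kX vX; clear; lia.
Qed.

Lemma received_clique1 X y : qclique X -> y \in X -> y \in lowV -> #|cluster y| = 1 ->
  ((q - 1)%:R <= received y)%R.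
Proof.
move=> kX yX yD cy; have [sX Xq cX] := kX.
have [a [aV aX eya Ea]] := clique_outer G kX yX yD.
(* The extreme case is degree q + 2, with surplus q + 2 and at most four neighbours of degree q. *)
apply: (@received_ge y (X :&: highV) q.+2 4) => // [v|].
  rewrite in_setI => /andP[vX vH]; have dv : q.+1 < deg v by move: vH; rewrite inE => /andP[].
  have vy : y != v.
    by apply: contraTneq dv => <-; rewrite (lowV_deg yD) ltnNge leqnSn.
  split=> //; first exact: cX.
  have := clique_low_nbrs kX yX yD vX; rewrite cy /surplus.
  move: (deg v) (low_nbrs v) dv => d n dv nd.
  have {}nd : n <= d.+2 - q by move: nd; clear; lia.
  have [m Em] : exists m, d = q.+2 + m by exists (d - q.+2); move: dv; clear; lia.
  have {}nd : n <= m + 4 by move: nd; rewrite Em; clear; lia.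
  apply: (@leq_trans (q.+2 * (m + 4))); first by rewrite leq_mul2l nd orbT.
  rewrite Em; have -> : (q.+2 + m) * q - (q * q + q - 2) = q.+2 + m * q.
    by move: q5; clear; nia.
  have : m * 2 <= m * q by rewrite leq_mul2l (ltnW q3) orbT.
  clear; lia.
(* All vertices of X of degree q or q + 1 are adjacent to a, so they make up at most half of X. The
   rest send at least (q/2)(q + 2)/4, which is at least q - 1 because (q - 2)(q - 4) >= 0. *)
have le : #|X :\: highV| <= ecount e [set a] X.
  rewrite ecount1; apply: subset_leq_card; apply/subsetP => v; rewrite in_setD => /andP[vH vX].
  have vV := subsetP sX _ vX; rewrite inE vX /=.
  have := min_deg G vV; rewrite leq_eqVlt => /orP[/eqP dv|].
    have vD : v \in lowV by rewrite inE vV -dv eqxx.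
    have : a \in cnbh e V v by rewrite (clique_low_twins G kX vX yX vD yD) Ea setU11.
    by rewrite inE esym => /andP[_ /orP[/eqP E|//]]; rewrite E vX in aX.
  rewrite leq_eqVlt => /orP[/eqP dv|lt].
    exact: (clique_degS_adj G q5 kX yX yD Ea aV aX vX).
  by move: vH; rewrite inE vV lt.
have le2 := clique_out_le G kX aV aX.
have := cardsID highV X; rewrite Xq; move: le le2.
move: #|_ :&: _| #|_ :\: _| (ecount _ _ _) => h l k lk kq hl.
have : q * q.+2 <= 2 * h * q.+2 by rewrite leq_mul2r; move: lk kq hl; clear; lia.
have : 5 * q <= q * q by rewrite leq_mul2r q5 orbT.
by move: q5; clear; nia.
Qed.

Lemma received_clique2 X y : qclique X -> y \in X -> y \in lowV -> 1 < #|cluster y| ->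
  ((q - 1)%:R <= received y)%R.
Proof.
move=> kX yX yD cy; have [sX Xq cX] := kX.
have tq := clique_cluster_le G kX yX yD.
pose t := #|cluster y|.
(* These are the surplus, and the bound on neighbours of degree q, at the least possible degree q +
   t; each further degree adds q to the former and 1 to the latter. *)
apply: (@received_ge y (X :\: cluster y) ((t - 1) * q + 2) (2 * t + 1)) => // [||].
- by rewrite addn1.
- move=> v; rewrite in_setD => /andP[vC vX]; have vV := subsetP sX _ vX.
  have vy : y != v.
    by apply: contraNneq vC => <-; apply: mem_cluster; apply: lowV_V yD.
  have eyv : e y v by apply: cX.
  have dv : q + t <= deg v.
    by apply: (cluster_nbr_deg G) => //; right; exists X.
  split=> //; first by rewrite inE vV /=; move: cy dv; rewrite -/t; clear; lia.
  have := clique_low_nbrs kX yX yD vX; rewrite /surplus -/t.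
  move: (deg v) (low_nbrs v) dv => d n dv nd.
  have [m Em] : exists m, d = q + t + m by exists (d - (q + t)); move: dv; clear; lia.
  have {}nd : n <= m + (2 * t + 1) by move: nd; rewrite Em; clear; lia.
  apply: (@leq_trans (((t - 1) * q + 2) * (m + (2 * t + 1)))); first by rewrite leq_mul2l nd orbT.
  rewrite Em; have -> : (q + t + m) * q - (q * q + q - 2) = (t - 1) * q + 2 + m * q.
    by move: q5 cy; rewrite -/t; clear; nia.
  have : ((t - 1) * q + 2) * m <= (2 * t + 1) * q * m.
    by rewrite leq_mul2r; apply/orP; right; move: q5 cy; rewrite -/t; clear; nia.
  clear; nia.
have sub : cluster y \subset X by rewrite (clique_cluster G kX yX yD) subsetIl.
have := cardsID (cluster y) X; rewrite (setIidPr sub) Xq -/t.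
move: #|_ :\: _| => h; move: tq cy; rewrite -/t; move: t => t tq t2 th.
have -> : h = q - t by move: th; clear; lia.
have [r Er] : exists r, q = 2 * t + r by exists (q - 2 * t); move: tq; clear; lia.
have [s Es] : exists s, t = s.+2 by exists t.-2; move: t2; clear; lia.
move: q5; rewrite {}Er {}Es; clear => sr.
have -> : 2 * s.+2 + r - 1 = 2 * s + r + 3 by lia.
have -> : 2 * s.+2 + r - s.+2 = s + r + 2 by lia.
have -> : s.+2 - 1 = s.+1 by [].
(* For t = 2 the claim reads 5(q - 1) <= q^2 - 4, true from q = 5 on but not for q = 4. In both
   cases the term given to [leq_addr] is the difference of the two sides, written with nonnegative
   coefficients. *)
case: s sr => [|s] sr.
  have [j ->] : exists j, r = j.+1 by exists r.-1; lia.
  apply: leq_trans (leq_addr (j * j + 5 * j + 1) _) (eq_leq _); clear; lia.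
apply: leq_trans (leq_addr (2 * s * s * s + 12 * s * s + 20 * s + 7 + 3 * r * s * s + 13 * r * s
  + 13 * r + r * r * s + 2 * r * r) _) (eq_leq _); clear; lia.
Qed.

Lemma received_big y : y \in lowV -> 1 < #|cluster y| -> (forall X, qclique X -> y \notin X) ->
  ((q - 2)%:R <= received y)%R.
Proof.
move=> yD cy noX; have tq := big_cluster_size G yD noX.
have cO := card_cluster_out G yD; pose t := #|cluster y|.
(* The same surplus at degree q + t, but without a q-clique the number of neighbours of degree q is
   bounded only by the degree. *)
apply: (@received_ge y (nbhV e V y :\: cluster y) ((t - 1) * q + 2) (q + t)) => // [||].
- by move: q5; clear; lia.
- move=> v; rewrite in_setD => /andP[vC vN].
  have /andP[vV eyv] : (v \in V) && e y v by move: vN; rewrite inE.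
  have dv : q + t <= deg v.
    by apply: (cluster_nbr_deg G) => //; left.
  split=> //; first by rewrite inE vV /=; move: cy dv; rewrite -/t; clear; lia.
  have := low_nbrs_deg v; rewrite /surplus -/t.
  move: (deg v) (low_nbrs v) dv => d n dv nd.
  have [m Em] : exists m, d = q + t + m by exists (d - (q + t)); move: dv; clear; lia.
  apply: (@leq_trans (((t - 1) * q + 2) * (q + t + m))); first by rewrite -Em leq_mul2l nd orbT.
  rewrite Em; have -> : (q + t + m) * q - (q * q + q - 2) = (t - 1) * q + 2 + m * q.
    by move: q5 cy; rewrite -/t; clear; nia.
  have : ((t - 1) * q + 2) * m <= (q + t) * q * m.
    by rewrite leq_mul2r; apply/orP; right; move: q5 cy; rewrite -/t; clear; nia.
  clear; nia.
move: cO tq cy; rewrite -/t; move: t #|_ :\: _| => t h th tq t2.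
have -> : h = q.+1 - t by move: th; clear; lia.
have [r Er] : exists r, q = t + r.+1 by exists (q - t.+1); move: tq; clear; lia.
have [s Es] : exists s, t = s.+2 by exists t.-2; move: t2; clear; lia.
rewrite {}Er {}Es; clear.
have -> : s.+2 + r.+1 - 2 = s + r.+1 by lia.
have -> : (s.+2 + r.+1).+1 - s.+2 = r + 2 by lia.
have -> : s.+2 - 1 = s.+1 by [].
apply: leq_trans (leq_addr (s + r + 5 + (s + r + 3) * s * r) _) (eq_leq _); lia.
Qed.

Lemma large_case : False.
Proof.
have tot := total_surplus G.
pose qcliqueb X := [&& X \subset V, #|X| == q & [forall x in X, forall y in X, (x != y) ==> e x y]].
have qP X : reflect (qclique X) (qcliqueb X).
  apply: (iffP and3P) => [[sX /eqP Xq /forall_inP cX]|[sX Xq cX]]; split=> //.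
  - by move=> x y xX yX xy; have /forall_inP/(_ y yX)/implyP := cX x xX; apply.
  - by apply/eqP.
  by apply/forall_inP => x xX; apply/forall_inP => y yX; apply/implyP; apply: cX.
pose Q := [set y in lowV | [exists X : {set T}, qcliqueb X && (y \in X)]].
pose A := [set y in lowV :\: Q | #|cluster y| == 1].
have QP y : y \in lowV -> reflect (exists2 X, qclique X & y \in X) (y \in Q).
  move=> yD; rewrite inE yD /=; apply: (iffP existsP) => [[X /andP[/qP kX yX]]|[X /qP kX yX]].
    by exists X.
  by exists X; rewrite kX.
have QD : Q \subset lowV by apply/subsetP => y; rewrite inE => /andP[].
have AP u : u \in A -> [/\ u \in lowV, u \notin Q & #|cluster u| = 1].
  by rewrite inE in_setD => /andP[/andP[uQ uD] /eqP cu].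
have AD : A \subset lowV by apply/subsetP => u /AP[].
have AQ u y : u \in A -> y \in lowV -> e u y -> y \in Q.
  move=> /AP[uD uQ cu] yD euy; have [Z [kZ yZ _]] := single_low_nbr G uD cu yD euy.
  by apply/QP => //; exists Z.
have Ai : {in A &, forall x y, ~~ e x y}.
  by move=> x y xA /AP[yD yQ _]; apply: contra yQ => /(AQ _ _ xA yD).
have BV : degS \subset V by apply/subsetP => b; rewrite inE => /andP[].
have Bd : {in degS, forall b, deg b = q.+1} by move=> b; rewrite inE => /andP[_ /eqP].
have dAB : [disjoint A & degS].
  rewrite -setI_eq0; apply/eqP/setP => x; rewrite in_setI in_set0; apply/negP => /andP[/AP[xD _ _] xB].
  by have := Bd x xB; rewrite (lowV_deg xD) => /eqP; rewrite (ltn_eqF (ltnSn q)).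
have K := low_degS_bound G AD Ai BV Bd dAB.
(* A vertex of Q has a single neighbour outside its q-clique, the only one that can lie in A. *)
have lowAQ : ecount e A lowV <= #|Q|.
  have le1 : ecount e A lowV <= ecount e A Q.
    rewrite !ecount_card; apply: leq_sum => u uA; apply: subset_leq_card; apply/subsetP => y.
    by rewrite inE => /andP[yD euy]; rewrite inE euy (AQ u y).
  apply: leq_trans le1 _; rewrite (ecountC esym) ecount_card -sum1_card; apply: leq_sum => y yQ.
  have yD := subsetP QD _ yQ; have [X kX yX] := QP y yD yQ.
  have [a [aV aX eya Ea]] := clique_outer G kX yX yD.
  rewrite -(cards1 a); apply: subset_leq_card; apply/subsetP => u.
  rewrite inE => /andP[/AP[uD uQ cu] eyu]; rewrite in_set1.
  have : u \in a |: X by rewrite -Ea inE (lowV_V uD) eyu orbT.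
  rewrite in_setU1 => /orP[//|uX]; case/negP: uQ; apply/QP => //; by exists X.
(* Breaking even takes q - 2. The extra unit on Q compensates for the edges between A and Q, along
   which A receives nothing. *)
pose lb y := if y \in Q then q - 1 else if y \in A then #|[set v in highV | e y v]| else q - 2.
have lbP : {in lowV, forall y, ((lb y)%:R <= received y)%R}.
  move=> y yD; rewrite /lb; have c0 : 0 < #|cluster y|.
    by apply/card_gt0P; exists y; apply: mem_cluster; apply: lowV_V yD.
  case: (QP y yD) => [[X kX yX]|noQ].
    have [c1|c1] := leqP #|cluster y| 1; last exact: received_clique2 kX yX yD c1.
    by apply: received_clique1 kX yX yD _; apply/eqP; rewrite eqn_leq c1.
  have noX X : qclique X -> y \notin X by move=> kX; apply/negP => yX; case: noQ; exists X.
  have yQ : y \notin Q by apply/negP => /(QP y yD).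
  case: ifP => yA; first exact: received_count.
  apply: received_big => //; rewrite ltn_neqAle c0 andbT eq_sym.
  by apply: contraFN yA => c1; rewrite inE in_setD yQ yD.
have := received_sum lbP.
rewrite (big_setID Q) /= (setIidPr QD) [X in _ + X <= _](big_setID A) /=.
have AE : (lowV :\: Q) :&: A = A.
  by apply/setIidPr/subsetP => u /AP[uD uQ _]; rewrite in_setD uQ uD.
rewrite AE.
have -> : \sum_(y in Q) lb y = (q - 1) * #|Q|.
  by rewrite mulnC -sum_nat_const; apply: eq_bigr => y yQ; rewrite /lb yQ.
have -> : \sum_(y in A) lb y = ecount e A highV.
  rewrite ecount_card; apply: eq_bigr => y yA; rewrite /lb yA.
  by have [_ /negbTE-> _] := AP y yA.
have -> : \sum_(y in (lowV :\: Q) :\: A) lb y = (q - 2) * #|(lowV :\: Q) :\: A|.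
  rewrite mulnC -sum_nat_const; apply: eq_bigr => y.
  by rewrite !in_setD /lb => /and3P[/negbTE-> /negbTE-> _].
have cQ := cardsID Q lowV; rewrite (setIidPr QD) in cQ.
have cA := cardsID A (lowV :\: Q); rewrite AE in cA.
have degA : ecount e A highV + ecount e A degS + ecount e A lowV = q * #|A|.
  rewrite !ecount_card -!big_split /= mulnC -sum_nat_const; apply: eq_bigr => u uA.
  by apply: (low_split G); have [] := AP u uA.
have : (q - 2) * #|lowV| = (q - 2) * #|Q| + (q - 2) * #|A| + (q - 2) * #|(lowV :\: Q) :\: A|.
  by rewrite -cQ -cA !mulnDr addnA.
have : (q - 2) * #|Q| + #|Q| = (q - 1) * #|Q| by move: q5; clear; nia.
have : (q - 2) * #|A| + 2 * #|A| = q * #|A| by move: q5; clear; nia.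
move: tot K lowAQ degA; clear; lia.
Qed.

End LargeCase.

Lemma no_min_cex (q : nat) (T : finType) (e : rel T) (V : {set T}) : ~ min_cex q e V.
Proof.
by move=> G; have [q4|q5] := leqP q 4; [apply: small_case G q4|apply: large_case G q5].
Qed.

Lemma ntwins_le (T : finType) (e : rel T) (V : {set T}) : ntwins e V <= #|V| * #|V|.
Proof. exact: (ecount_leM (fun x y => cnbh e V x == cnbh e V y)). Qed.

(** Lexicographic induction on the order, the edge count and n * n - ntwins, the last because more
    twins count as smaller; the ambient type varies along the induction. *)
Lemma dense_subset (q : nat) (T : finType) (e : rel T) (V : {set T}) : 3 <= q ->
  symmetric e -> irreflexive e -> ~~ col q e V -> has_dense q e V.
Proof.
move=> q3.
suff H n m d : forall (T : finType) (e : rel T) (V : {set T}), #|V| = n ->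
    ecount e V V = m -> n * n - ntwins e V = d ->
    symmetric e -> irreflexive e -> ~~ col q e V -> has_dense q e V.
  by apply: (H _ _ _ T e V).
elim/ltn_ind: n m d => n IHn; elim/ltn_ind => m IHm; elim/ltn_ind => d IHd {}T {}e {}V.
move=> En Em Ed es ei nc.
have [/existsP[W /and3P[sW ncW rW]]|noW] := boolP [exists W : {set T},
    [&& W \subset V, ~~ col q e W & (rho q e W <= rho_max q)%R]]; first by exists W.
case: (@no_min_cex q T e V); split=> //.
  by case=> W [sW ncW rW]; case/negP: noW; apply/existsP; exists W; rewrite sW ncW.
move=> T' e' V' es' ei' sm nc'; case: sm => [lt|[E [lt|[E' lt]]]].
- by apply: (IHn #|V'| _ _ _ T' e' V'); rewrite -?En.
- by apply: (IHm (ecount e' V' V') _ _ T' e' V'); rewrite -?Em // E.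
apply: (IHd (n * n - ntwins e' V') _ T' e' V'); rewrite ?E ?E' //.
have := ntwins_le e' V'; rewrite E En -Ed; move: lt; clear; lia.
Qed.

(** * Back to critical graphs and the bound F *)

Section Graphs.

Variables (T : finType) (G : graph T).

Definition adj : rel T := fun x y => (x != y) && ([set x; y] \in edges G).

Lemma adj_sym : symmetric adj.
Proof. by move=> x y; rewrite /adj eq_sym setUC. Qed.

Lemma adj_irr : irreflexive adj.
Proof. by move=> x; rewrite /adj eqxx. Qed.

Lemma edgeP x y : [set x; y] \in edges G -> [/\ x \in vertices G, y \in vertices G & x != y].
Proof.
move=> xyE; have /forall_inP/(_ _ xyE)/andP[] := edges_wf G.
by rewrite subUset !sub1set cards2 => /andP[-> ->]; case: (x != y).
Qed.

Lemma colorable_col q (W : {set T}) (H : graph T) : 0 < q -> vertices H = W ->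
  {in W &, forall x y, [set x; y] \in edges G -> [set x; y] \in edges H} ->
  colorable q H -> col q adj W.
Proof.
move=> q0 HW HE [c [cq cH]]; apply/colP.
exists (fun x => insubd (Ordinal q0) (c x)) => x y xW yW /andP[_ xyE].
apply/eqP => /(congr1 val); rewrite !val_insubd !cq ?HW //.
by apply: cH; apply: HE.
Qed.

Lemma col_colorable q : col q adj (vertices G) -> colorable q G.
Proof.
move=> /colP[c pc]; exists (fun x => c x); split=> // x y xyE.
have [xV yV xy] := edgeP xyE; have := pc x y xV yV; rewrite /adj xy xyE => /(_ isT) ne.
by move/val_inj => E; rewrite E eqxx in ne.
Qed.

Lemma ecount_adj_le : ecount adj (vertices G) (vertices G) <= 2 * #|edges G|.
Proof.
rewrite -card_crossing -sum1_card.
rewrite (partition_big (fun p => [set p.1; p.2]) [in edges G]) /=; last first.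
  by move=> p; rewrite inE => /and3P[_ _ /andP[]].
rewrite mulnC -sum_nat_const; apply: leq_sum => d dE.
have [[a b] /andP[pC /eqP Ed]|none] := pickP
  (fun p => (p \in crossing adj (vertices G) (vertices G)) && ([set p.1; p.2] == d)); last first.
  by rewrite big_pred0.
rewrite sum1_card; apply: (@leq_trans #|[set (a, b); (b, a)]|); last by rewrite cards2; case: (_ == _).
apply: subset_leq_card; apply/subsetP => -[x y] /andP[].
rewrite inE /= => /and3P[_ _ /andP[xy _]] /eqP E; rewrite -Ed /= in E.
have : x \in [set a; b] by rewrite -E !inE eqxx.
have : y \in [set a; b] by rewrite -E !inE eqxx orbT.
rewrite !inE !xpair_eqE => /orP[] /eqP Ey /orP[] /eqP Ex; subst x y; rewrite ?eqxx ?orbT //;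
  by rewrite eqxx in xy.
Qed.

(** The dense set W must be the whole vertex set: otherwise the subgraph induced on W is proper, and
    criticality colours it. *)
Lemma critical_rho q : 3 <= q -> critical q.+1 G -> (rho q adj (vertices G) <= rho_max q)%R.
Proof.
move=> q3 [/= ncG crit].
have [|W [sW ncW rW]] := dense_subset q3 adj_sym adj_irr (V := vertices G).
  by apply/negP => /col_colorable.
have [<-//|WV] := eqVneq W (vertices G); case/negP: ncW.
have wf : [forall d in [set d in edges G | d \subset W], (d \subset W) && (#|d| == 2)].
  apply/forall_inP => d; rewrite inE => /andP[dE ->] /=.
  by have /forall_inP/(_ _ dE)/andP[] := edges_wf G.
apply: (@colorable_col q W (Graph wf)) => //=; first by apply: leq_trans q3.
  by move=> x y xW yW xyE; rewrite inE xyE subUset !sub1set xW.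
apply: crit; split=> //=; first by apply/subsetP => d; rewrite inE => /andP[].
by case=> E _; rewrite E eqxx in WV.
Qed.

End Graphs.

(** With q = k - 1 the hypothesis is (q^2 + q - 2)n - 2qm <= q^2 - q - 2, rearranged without
    subtraction; the coefficients factor as (k + 1)(k - 2) and k(k - 3). *)
Lemma F_le (k n m : nat) : 4 <= k ->
  ((k.-1 * k.-1 + k.-1) * n + k.-1 + 2 <= 2 * k.-1 * m + k.-1 * k.-1 + 2 * n)%N ->
  (F k n <= m%:Z)%R.
Proof.
move=> k4; have [q Eq] : exists q, k = q.+1 by exists k.-1; rewrite prednK // (ltn_trans _ k4).
rewrite {}Eq in k4 *; rewrite succnK => H; rewrite /F ceil_le_int.
have q0 : (0 < q%:R :> rat)%R by rewrite ltr0n; move: k4; clear; lia.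
have -> : (q.+1%:R = q%:R + 1 :> rat)%R by rewrite -addn1 natrD.
rewrite ler_pdivrMr; last by lra.
move: H; rewrite -(ler_nat rat) !natrD !natrM !natrD !natrM; set Q := (q%:R)%R.
rewrite -[(m%:~R)%R]/((m%:R)%R); move: (n%:R)%R (m%:R)%R => N M.
by lra.
Qed.

Theorem theorem3 (k : nat) (hk : 4 <= k) :
  (forall (T : finType) (G : graph T),
      critical k G -> (F k #|vertices G| <= #|edges G|%:Z)%R) /\
  (forall n m : nat,
      k <= n -> n <> k + 1 -> is_f k n m -> (F k n <= m%:Z)%R).
Proof.
have main (T : finType) (G : graph T) : critical k G -> (F k #|vertices G| <= #|edges G|%:Z)%R.
  move=> cG; apply: F_le => //; have q3 : 3 <= k.-1 by move: hk; clear; lia.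
  have Ek : k.-1.+1 = k by rewrite prednK // (ltn_trans _ hk).
  move: cG q3; rewrite -{1}Ek; move: k.-1 => q cG q3.
  have := critical_rho q3 cG; rewrite /rho /rho_max.
  have : q * ecount (adj G) (vertices G) (vertices G) <= q * (2 * #|edges G|).
    by rewrite leq_mul2l ecount_adj_le orbT.
  clear; lia.
split=> // n m _ _ [[T [G [cG <- <-]]] _]; exact: main.
Qed.
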